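(* Suppose $1<p\le q<\infty$. If $b$ is a normal form parameter and $A_0=\sup_{x>0}b(x)^{1/p'}x^{1/q}$, then $A_0\le N_{p,q}(b)\le K_{p,q}A_0$.
   Context: $L^+$ is the set of Lebesgue measurable functions $(0,\infty)\to[0,\infty]$ and $\|\cdot\|_p$ is the usual $L^p$ norm for Lebesgue measure on $(0,\infty)$; $p',q'$ denote conjugate exponents, $\frac1p+\frac1{p'}=1$. A normal form parameter is a non-increasing function $b:(0,\infty)\to[0,\infty]$. Put $H_bf(x)=\int_0^{b(x)}f(t)\,dt$ for $f\in L^+$, and let $N_{p,q}(b)\in[0,\infty]$ be the smallest $C$ such that $\|H_bf\|_q\le C\|f\|_p$ for all $f\in L^+$ with $\|f\|_p<\infty$. For $1<p\le q<\infty$ the constant $K_{p,q}$ is $$K_{p,q}=p^{1/p}(p')^{1/p'}\ \text{ if }p=q,\qquad K_{p,q}=\Big(\frac{\Gamma(s)}{\Gamma(s/p)\Gamma(s/q')}\Big)^{1/s}\ \text{ if }p<q,\ \text{ where }\tfrac1s=\tfrac1p-\tfrac1q.$$ (By classical results of Hardy ($p=q$) and Bliss ($p<q$), $N_{p,q}(x^{-p'/q})=K_{p,q}$.) *)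

(* Defs.v *)
From HB Require Import structures.
From mathcomp Require Import all_boot all_order all_algebra.
From mathcomp Require Import all_classical all_reals all_analysis.
From mathcomp Require Import measurable_realfun.

Set Implicit Arguments.
Unset Strict Implicit.
Unset Printing Implicit Defensive.
Import Order.TTheory GRing.Theory Num.Theory.
Import numFieldNormedType.Exports.

Local Open Scope classical_set_scope.
Local Open Scope ring_scope.

(* The carrier is R itself; its measurable sets are all the Lebesgue measurable
   sets (Caratheodory sigma-algebra), not only the Borel ones. *)
Notation lebesgueType R :=
  (caratheodory_type ((wlength (idfun : R -> R))^*)%mu).

Notation leb R :=
  (@completed_lebesgue_measure R : {measure set (lebesgueType R) -> \bar R}).

(* A function on (0, +oo) is represented by a total function on R whose values
   outside (0, +oo) are never used. *)
Notation posline R := (`]0%R, +oo[%classic : set R).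

Definition Lplus (R : realType) : set (R -> \bar R) :=
  [set f : R -> \bar R | @measurable_fun _ _ (lebesgueType R) _ (posline R) f /\
           forall x, 0 < x -> (0 <= f x)%E].

Definition pnorm (R : realType) (p : R) (f : R -> \bar R) : \bar R :=
  Lnorm (leb R) p%:E (f \_ (posline R)).

Definition normal_form_parameter (R : realType) (b : R -> \bar R) : Prop :=
  (forall x, 0 < x -> (0 <= b x)%E) /\
  (forall x y, 0 < x -> x <= y -> (b y <= b x)%E).

Definition hardyop (R : realType) (b f : R -> \bar R) (x : R) : \bar R :=
  (\int[leb R]_(t in [set t : R | (0 < t)%R /\ (t%:E < b x)%E]) f t)%E.

Definition norm_bounds (R : realType) (p q : R) (b : R -> \bar R)
    : set (\bar R) :=
  [set C | (0 <= C)%E /\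
    forall f, Lplus f -> (pnorm p f < +oo)%E ->
      (pnorm q (hardyop b f) <= C * pnorm p f)%E].

(* The infimum is attained, see [opnorm_least]. *)
Definition opnorm (R : realType) (p q : R) (b : R -> \bar R) : \bar R :=
  ereal_inf (norm_bounds p q b).

Definition conj_exp (R : realType) (p : R) : R := fine (hoelder_conjugate p%:E).

Definition Gamma (R : realType) (s : R) : R :=
  \int[@lebesgue_measure R]_(t in `]0, +oo[) (t `^ (s - 1) * expR (- t)).

Definition bliss_const (R : realType) (p q : R) : R :=
  if p == q then p `^ p^-1 * (conj_exp p) `^ (conj_exp p)^-1
  else let s := (p^-1 - q^-1)^-1 in
    (Gamma s / (Gamma (s / p) * Gamma (s / conj_exp q))) `^ s^-1.

Definition A0 (R : realType) (p q : R) (b : R -> \bar R) : \bar R :=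
  ereal_sup [set ((b x) `^ (conj_exp p)^-1 * (x `^ q^-1)%:E)%E | x in posline R].

Lemma conj_expP (R : realType) (p : R) : 1 < p -> p^-1 + (conj_exp p)^-1 = 1.
Proof.
move=> p1; have p0 : p != 0 by rewrite gt_eqF// (lt_trans ltr01).
have q0 : p - 1 != 0 by rewrite subr_eq0 gt_eqF.
rewrite /conj_exp /hoelder_conjugate/= eqe (negbTE p0) -EFinB inver (negbTE q0)/=.
by rewrite invf_div mulrBl divff// mul1r addrC subrK.
Qed.

Lemma opnorm_least (R : realType) (p q : R) (b : R -> \bar R) :
  1 < p -> 1 < q ->
  norm_bounds p q b (opnorm p q b) /\
  forall C, norm_bounds p q b C -> (opnorm p q b <= C)%E.
Proof.
move=> p1 q1; split; last by move=> C; exact: ereal_inf_lbound.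
have inf0 : (0 <= opnorm p q b)%E by apply: le_ereal_inf_tmp => C [].
split=> // f [mf f0] finf.
have pf0 : (0 <= pnorm p f)%E by exact: Lnorm_ge0.
have mpos : measurable (posline R : set (lebesgueType R)).
  apply: sub_caratheodory; exact: measurable_itv.
have mI x : measurable
    ([set t : R | 0 < t /\ (t%:E < b x)%E] : set (lebesgueType R)).
  apply: sub_caratheodory.
  rewrite (_ : mkset _ = posline R `&` (@EFin R @^-1` `]-oo, b x[%classic)).
    apply: measurableI; first exact: measurable_itv.
    by rewrite -[X in measurable X]setTI; apply: EFin_measurable => //;
       exact: emeasurable_itv.
  by apply/seteqP; split=> t /=; rewrite !in_itv/= andbT.
have [pz|pn0] := eqVneq (pnorm p f) 0%E.
  rewrite pz mule0.
  have mfr : measurable_fun [set: lebesgueType R] (f \_ (posline R)).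
    exact: (measurable_restrictT _ mpos).1 mf.
  have p0 : (0 < p%:E)%E by rewrite lte_fin (lt_trans ltr01).
  have fae := Lnorm_eq0_eq0 mfr p0 pz.
  have H0 x : hardyop b f x = 0%E.
    rewrite /hardyop.
    transitivity (\int[leb R]_(t in [set t : R | (0 < t)%R /\ (t%:E < b x)%E]) 0)%E.
      apply: ae_eq_integral => //.
        apply: measurable_funS mf => //.
        by move=> t/= [t0 _]; rewrite in_itv/= t0.
      move: fae; apply: filterS => t /= /(_ I).
      by rewrite patchE => + [t0 _]; rewrite mem_set//= in_itv/= t0.
    exact: integral0.
  rewrite /pnorm (_ : hardyop b f \_ _ = cst 0%E) ?Lnorm0//.
    by rewrite eqe gt_eqF// (lt_trans ltr01).
  by apply/funext => x; rewrite patchE H0 if_same.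
have pgt0 : (0 < pnorm p f)%E by rewrite lt_def pn0.
have pE : pnorm p f \is a fin_num by rewrite ge0_fin_numE.
have fgt0 : 0 < fine (pnorm p f) by rewrite fine_gt0// pgt0.
rewrite -(fineK pE) -lee_pdivrMr//.
apply: le_ereal_inf_tmp => C [C0 HC].
by rewrite lee_pdivrMr// fineK//; exact: HC.
Qed.

(* Main.v *)
(* For the upper bound, [b x <= (A0 / x^(1/q))^p'], so that it suffices to bound
   [int F(y)^q d(- y^(-q/p'))], where [F y] is the integral of [f] over ]0, y].
   Put [w y = (F y / y)^p y].  For every [th] in [0, 1], convexity of [x^p] gives
     [f^p >= th^(p-1) w' + (p-1) th^(p-1) (1-th) (F/y)^p].
   If [p = q], the constant choice [th = 1/p'] is the inequality of Hardy.  If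
   [p < q], let [w] be maximal at [y0] and let [th] depend on [w] through
   [th^(p-1) (1-th) = (w/c)^(q/p-1)], taking the root [th >= 1/p'] before [y0]
   and the root [th <= 1/p'] after it, where [c] is such that both roots meet at
   [y0].  The second term is then [c^(1-q/p)] times a multiple of the integral to
   be bounded, while the first one integrates to [c] times a Beta integral,
   whatever [f] is; eliminating [c] by Young's inequality yields the constant of
   Bliss.  For the lower bound, test with the indicators of ]0, y], y < b x. *)
Require Import Defs.
From mathcomp Require Import all_boot all_order all_algebra.
From mathcomp Require Import all_classical all_reals all_analysis.
From mathcomp Require Import measurable_realfun ring lra.
Import Order.TTheory GRing.Theory Num.Theory.
Import numFieldNormedType.Exports.
Local Open Scope classical_set_scope.
Local Open Scope ring_scope.

(** * Powers *)

(** The equation for [th] is read off the extremals. With [r = q/p-1], let [F y = y (1+y^r)^(-1/r)]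
    and [f = F']. Then [f y / F = 1/(1+v)] for [v = y^r], and [w = (v (1+v)^(-p))^(1/r)], so that
    [th = 1/(1+v)] satisfies [th^(p-1) (1-th) = w^r], while the tangent of [x^p] at [th F/y] touches
    at [f]. Along this function [th] falls from 1 to 0, and [w] rises until [th = 1/p'], then falls:
    hence the two branches, which for a general [f] are glued at a maximum of [w]. As [f] is only
    measurable, [w'] is never formed. All inequalities bear on increments over [[c, d]]; the defects
    are products of [d - c] with increments of monotone functions and vanish under refinement. A
    maximum of [w] calls for a compact interval away from 0, so the argument runs on [[a, b]]: the
    part cut off at 0 enters only through [w a <= E a], and monotone convergence removes the
    truncation at the end. *)

Lemma ler_powR_base (R : realType) (s x y : R) :
  0 <= s -> 0 <= x -> x <= y -> x `^ s <= y `^ s.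
Proof. by move=> s0 x0 xy; rewrite ge0_ler_powR ?nnegrE// (le_trans x0). Qed.

Lemma ler_powRN_base (R : realType) (s x y : R) :
  0 <= s -> 0 < x -> x <= y -> y `^ (- s) <= x `^ (- s).
Proof.
move=> s0 x0 xy; have y0 := lt_le_trans x0 xy.
by rewrite !powRN lef_pV2 ?posrE ?powR_gt0// ler_powR_base// ltW.
Qed.

Lemma is_derive_powR1D (R : realType) (s z : R) : -1 < z ->
  is_derive z 1 (fun v : R => (1 + v) `^ s) (s * (1 + z) `^ (s - 1)).
Proof.
move=> z1; have z10 : 0 < 1 + z by lra.
have d1 : is_derive z (1 : R) (fun v : R => 1 + v) 1.
  by have := is_deriveD (is_derive_cst (1 : R) z 1) (is_derive_id z (1 : R)); rewrite add0r.
have := is_derive1_comp (is_derive1_powR s z10) d1.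
by rewrite mulr1.
Qed.
Lemma continuous_powR1D (R : realType) (s z : R) : -1 < z ->
  {for z, continuous (fun v : R => (1 + v) `^ s)}.
Proof.
move=> z1; apply/differentiable_continuous/derivable1_diffP.
by apply: ex_derive; exact: is_derive_powR1D.
Qed.

Lemma continuous_powR (R : realType) (s x : R) : 0 < x ->
  {for x, continuous (fun y : R => y `^ s)}.
Proof.
move=> x0; apply/differentiable_continuous/derivable1_diffP/derivable_powR.
by rewrite in_itv/= andbT.
Qed.

Lemma continuous_expRN (R : realType) : continuous (fun x : R => expR (- x)).
Proof.
by move=> x; apply: continuous_comp; [exact: opp_continuous|exact: continuous_expR].
Qed.

(** Young's inequality for [x] and [g^(p-1)] with exponents [p] and [p/(p-1)]; this covers [g = 0]
    without any derivative at 0. *)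
Lemma powR_tangent (R : realType) (p g x : R) : 1 < p -> 0 <= g -> 0 <= x ->
  p * g `^ (p - 1) * x - (p - 1) * g `^ p <= x `^ p.
Proof.
move=> p1 g0 x0; have p0 : 0 < p by lra.
have p10 : 0 < p - 1 by lra.
have := @conjugate_powR R x (g `^ (p - 1)) p (p / (p - 1)) x0 (powR_ge0 _ _) p0.
rewrite -powRrM mulrCA divff ?gt_eqF// mulr1 divr_gt0//.
move=> /(_ isT) H.
have /H : p^-1 + (p / (p - 1))^-1 = 1 by field; lra.
rewrite -(ler_pM2l p0) mulrDr.
rewrite [p * (x `^ p / p)](_ : _ = x `^ p); last by field; lra.
rewrite [p * (_ / (p / _))](_ : _ = (p - 1) * g `^ p); last by field; lra.
by rewrite [p * (x * _)]mulrCA mulrC => ?; lra.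
Qed.

(** After scaling by [c], this combines [ln (1 + t) <= t] with [1 + t <= expR t]. *)
Lemma powRN_tangent (R : realType) (k c d : R) : 0 <= k -> 0 < c -> c <= d ->
  c `^ (- k) - d `^ (- k) <= k * c `^ (- (k + 1)) * (d - c).
Proof.
move=> k0 c0 cd; have d0 : 0 < d by lra.
have ck := powR_gt0 (- k) c0.
rewrite opprD [c `^ (_ - _)]powRD; last by apply/implyP => _; rewrite gt_eqF.
rewrite powR_inv1 ?(ltW c0)//.
have -> : d `^ (- k) = c `^ (- k) * (d / c) `^ (- k).
  by rewrite -powRM ?divr_ge0 ?(ltW c0) ?(ltW d0)// mulrCA divff ?mulr1// gt_eqF.
have lnz : ln (d / c) <= (d - c) / c.
  have -> : d / c = 1 + (d - c) / c by field; lra.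
  apply: le_ln1Dx; rewrite (lt_le_trans (ltrN10 R))// divr_ge0 ?(ltW c0)//; lra.
have : 1 - k * ((d - c) / c) <= (d / c) `^ (- k).
  rewrite /powR gt_eqF ?divr_gt0// (le_trans _ (expR_ge1Dx _))// mulNr.
  by rewrite lerD2l lerN2 ler_wpM2l.
move=> /(ler_wpM2l (ltW ck)).
rewrite mulrBr mulr1 => H.
rewrite [X in _ <= X](_ : _ = c `^ (- k) * (k * ((d - c) / c))); last by field; lra.
move: H; move: (_ * (k * _)) (_ * _ `^ _) => X Y; lra.
Qed.

(* Summing over uniform partitions, the increments of [u] are at most
   [(m b - m a) * (b - a) / n] for every [n]. *)
Lemma nonincreasing_quadratic_increments (R : realType) (u m : R -> R) (a b : R) :
  a <= b ->
  (forall c d, a <= c -> c <= d -> d <= b -> u d - u c <= (m d - m c) * (d - c)) ->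
  u b <= u a.
Proof.
move=> ab H.
have key (n : nat) : u b - u a <= (m b - m a) * (b - a) / n.+1%:R.
  set h := (b - a) / n.+1%:R.
  have h0 : 0 <= h by rewrite divr_ge0// subr_ge0.
  have hn : h * n.+1%:R = b - a by rewrite /h divfK// pnatr_eq0.
  pose x i := a + h * i%:R.
  have G i : (i <= n.+1)%N -> u (x i) - u (x 0%N) <= (m (x i) - m (x 0%N)) * h.
    elim: i => [|i IH] iN; first by rewrite !subrr mul0r.
    have := IH (ltnW iN).
    have xi : x i.+1 - x i = h by rewrite /x -natr1; ring.
    have : u (x i.+1) - u (x i) <= (m (x i.+1) - m (x i)) * h.
      rewrite -[X in _ * X]xi; apply: H.
      - by rewrite /x lerDl mulr_ge0.
      - by rewrite -subr_ge0 xi.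
      - rewrite -lerBrDl -hn ler_wpM2l// ler_nat//.
    by move=> *; nra.
  have := G n.+1 (leqnn _).
  by rewrite /x mulr0 addr0 hn subrKC /h mulrA.
rewrite -subr_le0 leNgt; apply/negP => up.
set D := (m b - m a) * (b - a) in key.
have D0 : 0 < D by have := lt_le_trans up (key 0%N); rewrite divr1.
have [n Hn] : exists n : nat, D / (u b - u a) < n.+1%:R.
  exists (Num.truncn (D / (u b - u a))).
  by have /andP[_] := truncn_itv (divr_ge0 (ltW D0) (ltW up)).
have := key n; rewrite ler_pdivlMr ?ltr0n// leNgt => /negP; apply.
by move: Hn; rewrite ltr_pdivrMr// mulrC.
Qed.

(** Solved for [I], the hypothesis reads [I <= (r+1) c^r (E - c al)]. The conclusion is the maximum
    of this bound over [c], and the tangent of [x^(r+1)] at [c] compares the two. *)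
Lemma optimize_amplitude (R : realType) (r al c E I : R) :
  0 < r -> 0 < al -> 0 < c -> 0 <= E ->
  c * al + c `^ (- r) / (r + 1) * I <= E ->
  I <= (r / ((r + 1) * al)) `^ r * E `^ (r + 1).
Proof.
move=> r0 al0 c0 E0 H.
have r1 : 0 < r + 1 by lra.
have cr : 0 < c `^ r by rewrite powR_gt0.
(* The maximizer of [c^r (E - c al)] in [c]. *)
pose x := r / ((r + 1) * al) * E.
have k0 : 0 <= r / ((r + 1) * al) by rewrite divr_ge0 ?mulr_ge0 ?(ltW r0) ?(ltW r1) ?(ltW al0).
have x0 : 0 <= x by rewrite mulr_ge0.
have r11 : 1 < r + 1 by lra.
have := powR_tangent R (r + 1) c x r11 (ltW c0) x0.
rewrite (_ : r + 1 - 1 = r); last by ring.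
have s0 : 0 < (r + 1) * al / r by rewrite divr_gt0 ?mulr_gt0.
have cE : c `^ (r + 1) = c `^ r * c.
  by rewrite powRD ?powRr1 ?(ltW c0)//; apply/implyP => _; rewrite gt_eqF.
have EE : E `^ (r + 1) = E `^ r * E.
  by rewrite powRD ?powRr1//; apply/implyP; rewrite gt_eqF.
have xE : x `^ (r + 1) = x `^ r * x.
  by rewrite powRD ?powRr1//; apply/implyP; rewrite gt_eqF.
rewrite xE cE EE => /(ler_wpM2l (ltW s0)).
have -> : (r + 1) * al / r * (x `^ r * x) = (r / ((r + 1) * al)) `^ r * (E `^ r * E).
  rewrite {1}/x powRM// /x; move: (_ `^ r) (E `^ r) => A B.
  by field; rewrite !gt_eqF//; lra.
apply: le_trans.
have -> : (r + 1) * al / r * ((r + 1) * c `^ r * x - r * (c `^ r * c)) =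
   (r + 1) * c `^ r * (E - c * al).
  by rewrite /x; move: (_ `^ r) => A; field; rewrite !gt_eqF//; lra.
have : (r + 1) * c `^ r * (c `^ (- r) / (r + 1) * I) <= (r + 1) * c `^ r * (E - c * al).
  by rewrite ler_wpM2l ?mulr_ge0 ?(ltW r1) ?(ltW cr)//; lra.
apply: le_trans; rewrite powRN le_eqVlt; apply/orP; left; apply/eqP.
by field; rewrite !gt_eqF//; lra.
Qed.

(** * The truncated inequality for monotone primitives *)

Section bliss_core.
Context (R : realType) (p q a b : R) (F E I : R -> R).
Hypotheses (p1 : 1 < p) (pq : p <= q) (a0 : 0 < a) (ab : a <= b).
Hypothesis (Fa : 0 <= F a).
Hypothesis (ndF : forall c d, a <= c -> c <= d -> d <= b -> F c <= F d).
(** [E y] stands for the integral of [f^p] over []0, y]]: this is the tangent of [x^p] at a constant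
    [g], integrated over []c, d]]. *)
Hypothesis (EF : forall g c d, 0 <= g -> a <= c -> c <= d -> d <= b ->
  p * g `^ (p - 1) * (F d - F c) - (p - 1) * g `^ p * (d - c) <= E d - E c).
Let k := q - q / p.
(** [I] stands for the integral of [F^q d(- y^(-k))], with [F] replaced by its value at the right
    end. *)
Hypothesis (IF : forall c d, a <= c -> c <= d -> d <= b ->
  I d - I c <= F d `^ q * (c `^ (- k) - d `^ (- k))).

Let w y := (F y / y) `^ p * y.

Let F0 c : a <= c -> c <= b -> 0 <= F c.
Proof. by move=> ac cb; rewrite (le_trans Fa)// ndF. Qed.

(* Tangents of [x^p] at [th * (F d / d)], for [f], and at [F d / d], for [w]. *)
Lemma bliss_step th c d : 0 <= th -> th <= 1 -> a <= c -> c <= d -> d <= b ->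
  th `^ (p - 1) * (w d - w c) +
    (p - 1) * (th `^ (p - 1) * (1 - th)) * (F d / d) `^ p * (d - c) <= E d - E c.
Proof.
move: (p1) (a0) => p1' a0' th0 th1 ac cd db; have c0 : 0 < c by lra.
have d0 : 0 < d by lra.
have Fd := F0 d (le_trans ac cd) db; have Fc := F0 c ac (le_trans cd db).
set g := F d / d.
have g0 : 0 <= g by rewrite divr_ge0// ltW.
have := EF _ _ _ (mulr_ge0 th0 g0) ac cd db.
rewrite !(powRM _ th0 g0).
have tan := powR_tangent R p g (F c / c) p1 g0 (divr_ge0 Fc (ltW c0)).
have t0 : 0 <= th `^ (p - 1) by exact: powR_ge0.
have E1 : g * g `^ (p - 1) = g `^ p by rewrite mulr_powRB1//; lra.
have E2 : th * th `^ (p - 1) = th `^ p by rewrite mulr_powRB1//; lra.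
(* Multiplied by [y], the tangent at [g] is exact for [w] at [d], because [F d = g d], and lies
   below [w] at [c]. Hence [w d - w c] is at most [p g^(p-1) (F d - F c) - (p-1) g^p (d - c)]. *)
have wd : w d = p * g `^ (p - 1) * F d - (p - 1) * g `^ p * d.
  by rewrite /w -/g -E1 /g; field; lra.
have wc : p * g `^ (p - 1) * F c - (p - 1) * g `^ p * c <= w c.
  have -> : p * g `^ (p - 1) * F c - (p - 1) * g `^ p * c =
    (p * g `^ (p - 1) * (F c / c) - (p - 1) * g `^ p) * c by field; lra.
  by rewrite ler_wpM2r// ltW.
move=> H; apply: le_trans H.
rewrite -E2.
have : th `^ (p - 1) * (w d - w c) <= th `^ (p - 1) *
  (p * g `^ (p - 1) * (F d - F c) - (p - 1) * g `^ p * (d - c)).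
  by rewrite ler_wpM2l// wd; lra.
move: (g `^ (p - 1)) (g `^ p) (th `^ (p - 1)) => A B C; lra.
Qed.

(* [U] plays the role of the integral of [th^(p-1) dw]; the two alternatives
   are those of a concave and of a convex function of [w]. *)
Lemma bliss_branch (a1 b1 kk : R) (U th : R -> R) : a <= a1 -> a1 <= b1 -> b1 <= b ->
  0 <= kk ->
  (forall y, a1 <= y -> y <= b1 -> 0 <= th y <= 1 /\
    th y `^ (p - 1) * (1 - th y) = kk * w y `^ (q / p - 1)) ->
  (forall c d, a1 <= c -> c <= d -> d <= b1 ->
     U d - U c <= th c `^ (p - 1) * (w d - w c) \/
     U d - U c <= th d `^ (p - 1) * (w d - w c)) ->
  U b1 - U a1 + kk * (p - 1) / k * (I b1 - I a1) <= E b1 - E a1.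
Proof.
move: (p1) (pq) (a0) (ab) => p1' pq' a0' ab' aa1 ab1 bb1 kk0 Hth HU.
have p0 : 0 < p by lra.
have q0 : 0 < q by lra.
have p10 : 0 <= p - 1 by lra.
have qp0 : 0 <= q - p by lra.
have kE : k = (q / p) * (p - 1) by rewrite /k; field; lra.
have k0 : 0 < k by rewrite kE mulr_gt0// ?divr_gt0//; lra.
have k10 : 0 <= k + 1 by rewrite addr_ge0 ?(ltW k0).
have r0 : 0 <= q / p - 1 by rewrite subr_ge0 ler_pdivlMr// mul1r.
have K0 : 0 <= kk * (p - 1) by rewrite mulr_ge0//; lra.
pose C := kk * (p - 1) * F b `^ p.
(* The increments of [m] dominate the defect caused by evaluating [F], [w] and [y^(-(k+1))] at
   different points of [[c, d]]. *)
pose m y := C * (a `^ (- (k + 1)) * F y `^ (q - p) - F b `^ (q - p) * y `^ (- (k + 1))).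
pose u y := U y + kk * (p - 1) / k * I y - E y.
suff : u b1 <= u a1 by rewrite /u; lra.
apply: (nonincreasing_quadratic_increments R u m) => // c d ac cd db.
have ac' := le_trans aa1 ac; have db' := le_trans db bb1.
have c0 := lt_le_trans a0 ac'; have d0 := lt_le_trans c0 cd.
have Fc := F0 c ac' (le_trans cd db'); have Fd := F0 d (le_trans ac' cd) db'.
have Fcd := ndF _ _ ac' cd db'.
have [z [zc zd Hz]] : exists z, [/\ c <= z, z <= d &
    U d - U c <= th z `^ (p - 1) * (w d - w c)].
  by case: (HU _ _ ac cd db) => ?; [exists c|exists d].
have [/andP[t0 t1] tz] := Hth z (le_trans ac zc) (le_trans zd db).
have := bliss_step _ _ _ t0 t1 ac' cd db'; rewrite tz => Hstep.
have HI := IF _ _ ac' cd db'.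
have Hk := powRN_tangent R k c d (ltW k0) c0 cd.
have Fdq : 0 <= F d `^ q by exact: powR_ge0.
have kk2 : kk * (p - 1) / k * (I d - I c) <=
    kk * (p - 1) * (F d `^ q * c `^ (- (k + 1))) * (d - c).
  rewrite (_ : kk * (p - 1) * (F d `^ q * c `^ (- (k + 1))) * (d - c) =
    kk * (p - 1) / k * (F d `^ q * (k * c `^ (- (k + 1)) * (d - c)))); last by field; rewrite gt_eqF.
  rewrite ler_wpM2l ?divr_ge0 ?(ltW k0)//.
  by apply: (le_trans HI); rewrite ler_wpM2l.
have z0 : 0 < z by exact: lt_le_trans c0 zc.
have Fz : F c <= F z by exact: ndF ac' zc (le_trans zd db').
(* At a single point, [w^(q/p-1) (F/y)^p] equals [F^q y^(-(k+1))], which is the density of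
   [F^q d(- y^(-k))] divided by [k]. With [z] anywhere in [[c, d]], monotonicity leaves this
   inequality. *)
have wz : F c `^ (q - p) * d `^ (- (k + 1)) * F d `^ p <=
    w z `^ (q / p - 1) * (F d / d) `^ p.
  rewrite [(F d / d) `^ p]powRM ?invr_ge0 ?(ltW d0)//.
  rewrite -[d^-1]powR_inv1 ?(ltW d0)// -powRrM.
  have -> : - (k + 1) = (1 - p) * (q / p - 1) + -1 * p by rewrite /k; field; rewrite gt_eqF.
  rewrite [d `^ _]powRD; last by apply/implyP => _; rewrite gt_eqF.
  have -> : q - p = p * (q / p - 1) by field; rewrite gt_eqF.
  rewrite [d `^ ((1 - p) * _)]powRrM [F c `^ _]powRrM mulrA -powRM ?powR_ge0//.
  rewrite mulrAC -mulrA ler_wpM2r ?mulr_ge0 ?powR_ge0//.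
  apply: ge0_ler_powR => //; rewrite ?nnegrE ?mulr_ge0 ?powR_ge0 ?(ltW z0)//.
  rewrite /w powRM ?invr_ge0 ?(ltW z0) ?(le_trans Fc Fz)//.
  rewrite -mulrA.
  have -> : z^-1 `^ p * z = z `^ (1 - p).
    rewrite -powR_inv1 ?(ltW z0)// -powRrM -{2}[z]powRr1 ?(ltW z0)// -powRD.
      by congr (_ `^ _); ring.
    by apply/implyP => _; rewrite gt_eqF.
  rewrite ler_pM ?powR_ge0//.
    exact: ler_powR_base (ltW p0) Fc Fz.
  rewrite -[1 - p]opprB; exact: ler_powRN_base p10 z0 zd.
have Fb : 0 <= F b by exact: F0 ab (lexx b).
have Fdb : F d <= F b by exact: ndF (le_trans ac' cd) db' (lexx b).
have e1 : F c `^ (q - p) <= F d `^ (q - p) by exact: ler_powR_base qp0 Fc Fcd.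
have e2 : F c `^ (q - p) <= F b `^ (q - p).
  exact: ler_powR_base qp0 Fc (le_trans Fcd Fdb).
have e3 : F d `^ p <= F b `^ p by exact: ler_powR_base (ltW p0) Fd Fdb.
have e4 := ler_powRN_base R (k + 1) c d k10 c0 cd.
have e5 := ler_powRN_base R (k + 1) a c k10 a0 ac'.
have e6 : 0 <= F c `^ (q - p) by exact: powR_ge0.
have e7 : 0 <= F d `^ p by exact: powR_ge0.
have e8 : F d `^ q = F d `^ p * F d `^ (q - p).
  rewrite -powRD; first by congr (_ `^ _); ring.
  by apply/implyP; rewrite subrKC gt_eqF.
have e9 : 0 <= a `^ (- (k + 1)) by exact: powR_ge0.
have e10 : 0 <= c `^ (- (k + 1)) by exact: powR_ge0.
set Z := (a `^ (- (k + 1)) * (F d `^ (q - p) - F c `^ (q - p)) +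
   F b `^ (q - p) * (c `^ (- (k + 1)) - d `^ (- (k + 1)))).
have mZ : m d - m c = kk * (p - 1) * (F b `^ p * Z).
  by rewrite /m /Z /C; ring.
have main : F d `^ q * c `^ (- (k + 1)) - w z `^ (q / p - 1) * (F d / d) `^ p <=
     F b `^ p * Z.
  apply: (@le_trans _ _ (F d `^ p * Z)); last first.
    by rewrite ler_wpM2r// addr_ge0// mulr_ge0 ?powR_ge0// subr_ge0.
  rewrite e8.
  apply: (@le_trans _ _ (F d `^ p * (F d `^ (q - p) * c `^ (- (k + 1)) -
     F c `^ (q - p) * d `^ (- (k + 1))))).
    by rewrite mulrBr -mulrA lerD2l lerN2 mulrC.
  rewrite ler_wpM2l//.
  rewrite [X in X <= _](_ : _ = c `^ (- (k + 1)) * (F d `^ (q - p) - F c `^ (q - p)) +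
   F c `^ (q - p) * (c `^ (- (k + 1)) - d `^ (- (k + 1)))); last by ring.
  by rewrite /Z lerD// ler_wpM2r// subr_ge0.
have dc0 : 0 <= d - c by rewrite subr_ge0.
have /(ler_wpM2l K0) := main.
rewrite -mZ => /(ler_wpM2r dc0) main'.
apply: le_trans main'.
rewrite /u.
set A := kk * (p - 1) / k in kk2 *.
set B := w z `^ _ in Hstep *.
set D := (F d / d) `^ p in Hstep *.
set G := F d `^ q * _ in kk2 *.
set V := _ `^ (p - 1) * _ in Hstep Hz.
rewrite [_ * (G - _) * _](_ : _ = kk * (p - 1) * G * (d - c) -
  (p - 1) * (kk * B) * D * (d - c)); last by ring.
move: Hz Hstep kk2; clear; lra.
Qed.

(** A large [g] in [EF] bounds [F d - F c] by a small multiple of [E b - E a] plus a constant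
    multiple of [d - c]. Continuity is what makes [w] attain its maximum in [bliss_core]. *)
Lemma bliss_primitive_continuous : {within `[a, b], continuous F}.
Proof.
move: (p1) (a0) (ab) => p1' a0' ab'.
have mono c d : a <= c -> c <= d -> d <= b -> E c <= E d.
  move=> ac cd db; have := EF _ _ _ (lexx 0) ac cd db.
  by rewrite !powR0 ?gt_eqF//; lra.
have unif e : 0 < e -> exists2 del, 0 < del &
    forall c d, a <= c -> c <= d -> d <= b -> d - c <= del -> F d - F c <= e.
  move=> e0.
  (* With [g^(p-1) = D], half of [p e D] absorbs [E b - E a] and the other half absorbs
     [(p-1) g^p (d - c)]; adding 1 keeps [D] positive. *)
  pose D := 2 * (E b - E a) / (p * e) + 1.
  have pe : 0 < p * e by rewrite mulr_gt0//; lra.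
  have Eab := mono _ _ (lexx a) ab (lexx b).
  have D0 : 0 < D by rewrite ltr_wpDl// divr_ge0 ?(ltW pe)//; lra.
  pose g := D `^ (p - 1)^-1.
  have g0 : 0 < g by rewrite powR_gt0.
  have gD : g `^ (p - 1) = D.
    by rewrite /g -powRrM mulVf ?powRr1 ?(ltW D0)// gt_eqF//; lra.
  have gp : 0 < (p - 1) * g `^ p by rewrite mulr_gt0 ?powR_gt0//; lra.
  exists (p * e * D / 2 / ((p - 1) * g `^ p)).
    by rewrite divr_gt0// divr_gt0// mulr_gt0.
  move=> c d ac cd db; rewrite ler_pdivlMr// => dc.
  have := EF _ _ _ (ltW g0) ac cd db; rewrite gD => H.
  have Ecd : E d - E c <= E b - E a.
    by rewrite lerB// mono//; lra.
  have D1 : E b - E a <= p * e * D / 2.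
    by rewrite /D (_ : p * e * _ / 2 = E b - E a + p * e / 2); [lra|field; lra].
  have : p * D * (F d - F c) <= p * D * e by lra.
  by rewrite ler_pM2l// mulr_gt0//; lra.
apply/subspace_continuousP => x /=; rewrite in_itv/= => /andP[ax xb].
apply/cvgrPdist_le => e e0; have [del del0 H] := unif _ e0.
rewrite near_withinE; near=> y; rewrite /= in_itv/= => /andP[ay yb].
have xy : `|x - y| <= del.
  by near: y; apply: (@cvgr_dist_le _ _ _ (nbhs x) _ id x).
have [lexy|/ltW leyx] := leP x y.
  rewrite distrC ger0_norm ?subr_ge0 ?ndF// H//.
  by move: xy; rewrite distrC ger0_norm// subr_ge0.
rewrite ger0_norm ?subr_ge0 ?ndF// H//.
by move: xy; rewrite ger0_norm// subr_ge0.
Unshelve. all: by end_near. Qed.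

(** The exponent [q/p - 1] of [w] vanishes, so a constant [th] is admissible. The value [1/p']
    maximizes [th^(p-1) (1-th)], the coefficient in front of [I]. The boundary term at [b] is
    nonnegative and the one at [a] is absorbed by [w a <= E a]. *)
Lemma hardy_core : p = q -> w a <= E a ->
  I b - I a <= p * (p / (p - 1)) `^ (p - 1) * E b.
Proof.
move=> pqE wE; move: (p1) (a0) (ab) => p1' a0' ab'.
have p10 : 0 < p - 1 by lra.
pose t := (p - 1) / p.
have t0 : 0 < t by rewrite divr_gt0//; lra.
have t1 : t <= 1 by rewrite ler_pdivrMr; lra.
set T := t `^ (p - 1).
have T0 : 0 < T by rewrite powR_gt0.
have T1 : T <= 1.
  rewrite (_ : 1 = 1 `^ (p - 1)); last by rewrite powR1.
  by rewrite ge0_ler_powR ?nnegrE ?(ltW p10) ?(ltW t0).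
have r0 : q / p - 1 = 0 by rewrite -pqE; field; lra.
have := bliss_branch a b (T * (1 - t)) (fun y => T * w y) (fun=> t) (lexx _) ab (lexx _).
have kk0 : 0 <= T * (1 - t) by rewrite mulr_ge0 ?(ltW T0)//; lra.
move=> /(_ kk0) H.
have {H} := H _ _.
have -> : k = p - 1 by rewrite /k -pqE; field; lra.
rewrite -(mulrA _ (p - 1)) divff ?mulr1 ?gt_eqF//.
rewrite (_ : 1 - t = p^-1); last by rewrite /t; field; lra.
move=> H.
have {H} : T * w b - T * w a + T * p^-1 * (I b - I a) <= E b - E a.
  apply: H.
    by move=> y _ _; rewrite (ltW t0) t1 r0 powRr0 mulr1.
  by move=> c d _ _ _; left; rewrite mulrBr.
have wa : 0 <= w a by rewrite mulr_ge0 ?powR_ge0// ltW.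
have wb : 0 <= w b by rewrite mulr_ge0 ?powR_ge0//; lra.
have Twb : 0 <= T * w b by rewrite mulr_ge0// ltW.
have Twa : T * w a <= w a by rewrite ler_piMl.
move=> H.
have : T * p^-1 * (I b - I a) <= E b by lra.
have -> : (p / (p - 1)) `^ (p - 1) = T^-1.
  have -> : p / (p - 1) = t `^ (-1) by rewrite powR_inv1 ?(ltW t0)// /t invf_div.
  by rewrite -powRrM mulN1r powRN.
rewrite -ler_pdivlMl; last by rewrite mulr_gt0// invr_gt0; lra.
by rewrite invfM invrK [p * T^-1]mulrC.
Qed.

Let r := q / p - 1.
Let vm := (p - 1)^-1.

(* Roots [th] are parametrized by [th = 1 / (1 + v)]: then [th^(p-1) (1-th)] is
   [psi v ^ r], which peaks at [vm].  With [S v] the integral of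
   [psi d(-(1+v)^(1-p))] over [v, +oo[, the integral of [th^(p-1) dw] is
   [(1+v)^(1-p) w + c0 (S 0 - S v)], which is minimal in [v] at the root on the
   branch [v <= vm] and maximal on the branch [vm <= v]. *)
Lemma bliss_core (S psi : R -> R) : p < q -> w a <= E a ->
  {within `[a, b], continuous F} ->
  (forall v, 0 <= v -> psi v = (v * (1 + v) `^ (- p)) `^ r^-1) ->
  (forall u v, 0 <= u -> u <= v -> v <= vm ->
     psi u * ((1 + u) `^ (1 - p) - (1 + v) `^ (1 - p)) <= S u - S v <=
     psi v * ((1 + u) `^ (1 - p) - (1 + v) `^ (1 - p))) ->
  (forall u v, vm <= u -> u <= v ->
     psi v * ((1 + u) `^ (1 - p) - (1 + v) `^ (1 - p)) <= S u - S v <=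
     psi u * ((1 + u) `^ (1 - p) - (1 + v) `^ (1 - p))) ->
  (forall v, vm <= v -> S v <= psi v * (1 + v) `^ (1 - p)) ->
  0 < S 0 ->
  I b - I a <= (r / ((r + 1) * S 0)) `^ r * E b `^ (q / p).
Proof.
move=> ltpq wE cF psiE Srise Sfall Stail S0.
move: (p1) (a0) (ab) => p1' a0' ab'.
have p10 : 0 < p - 1 by lra.
have p0 : 0 < p by lra.
have q0 : 0 < q by lra.
have r0 : 0 < r by rewrite /r subr_gt0 ltr_pdivlMr// mul1r.
have r1 : r + 1 = q / p by rewrite /r; ring.
have kE : k = (q / p) * (p - 1) by rewrite /k; field; lra.
have k0 : 0 < k by rewrite kE mulr_gt0// divr_gt0.
have vm0 : 0 < vm by rewrite invr_gt0.
have E0 y : a <= y -> y <= b -> 0 <= E y.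
  move=> ay yb; have := EF _ _ _ (lexx 0) (lexx a) ay yb.
  rewrite !powR0 ?gt_eqF//.
  have wa : 0 <= w a by rewrite mulr_ge0 ?powR_ge0// ltW.
  by rewrite !mulr0 !mul0r subr0 subr_ge0; exact: le_trans (le_trans wa wE).
have Fb := F0 b ab (lexx b).
rewrite -r1.
(* When [F b = 0], [w] vanishes throughout and leaves no positive amplitude, but [IF] then gives
   [I b <= I a]. *)
move: Fb; rewrite le_eqVlt => /predU1P[Fb|Fb].
  have := IF _ _ (lexx a) ab (lexx b).
  rewrite -Fb powR0 ?gt_eqF// mul0r => /le_trans; apply.
  by rewrite mulr_ge0 ?powR_ge0.
have [y0 y0ab y0max] : exists2 y0, y0 \in `[a, b] &
    forall y, y \in `[a, b] -> w y <= w y0.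
  (* Since [w = phi^p], it is enough to maximize [phi], whose only power has its base in [[a, b]],
     away from 0. *)
  pose phi y := F y * y `^ (p^-1 - 1).
  have phiE y : a <= y -> y <= b -> w y = phi y `^ p.
    move=> ay yb; have yg0 := lt_le_trans a0 ay.
    have Fy := F0 y ay yb.
    rewrite /w /phi !powRM ?powR_ge0 ?invr_ge0 ?(ltW yg0)// -mulrA; congr (_ * _).
    rewrite -powR_inv1 ?(ltW yg0)// -!powRrM -{2}[y]powRr1 ?(ltW yg0)// -powRD.
      by congr (_ `^ _); field; rewrite gt_eqF.
    by apply/implyP => _; rewrite gt_eqF.
  have cphi : {within `[a, b], continuous phi}.
    have cg : {within `[a, b], continuous (fun y => y `^ (p^-1 - 1))}.
      apply: continuous_in_subspaceT => x; rewrite inE/= in_itv/= => /andP[ax _].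
      apply/differentiable_continuous/derivable1_diffP/derivable_powR.
      by rewrite in_itv/= andbT (lt_le_trans a0).
    move=> x; apply: (@continuousM R (subspace `[a, b]) F (fun y => y `^ (p^-1 - 1))).
      exact: cF.
    exact: cg.
  have [y0 y0ab Hy0] := EVT_max ab cphi.
  exists y0 => // y yab; move: (yab) (y0ab); rewrite !in_itv/= => /andP[ay yb] /andP[ay0 y0b].
  rewrite (phiE y ay yb) (phiE y0 ay0 y0b); apply: ler_powR_base (ltW p0) _ (Hy0 _ yab).
  by rewrite mulr_ge0 ?powR_ge0 ?F0.
move: y0ab; rewrite in_itv/= => /andP[ay0 y0b].
have w0 y : a <= y -> y <= b -> 0 <= w y.
  by move=> ay yb; rewrite mulr_ge0 ?powR_ge0// (le_trans (ltW a0)).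
have wpos y : a <= y -> 0 < F y -> 0 < w y.
  move=> ay Fy; have yg0 := lt_le_trans a0 ay.
  by rewrite mulr_gt0// powR_gt0// divr_gt0.
have wy0 : 0 < w y0.
  by rewrite (lt_le_trans (wpos b ab Fb))// y0max// in_itv/= ab lexx.
pose chi v := v * (1 + v) `^ (- p).
have chi_gt0 v : 0 < v -> 0 < chi v by move=> v0; rewrite mulr_gt0// powR_gt0// addr_gt0.
have chi_ge0 v : 0 <= v -> 0 <= chi v by move=> v0; rewrite mulr_ge0// powR_ge0.
have cchi x y : 0 <= x -> {within `[x, y], continuous chi}.
  move=> x0; apply: continuous_in_subspaceT => z; rewrite inE/= in_itv/= => /andP[xz _].
  apply: (@continuousM _ _ id (fun z => (1 + z) `^ (- p))); first exact: cvg_id.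
  by apply: continuous_powR1D; rewrite (lt_le_trans (ltrN10 R))// (le_trans x0).
(* The amplitude for which the peak of [c0 psi] is the maximum of [w], so that [vm] is a root at
   [y0]. *)
pose c0 := w y0 / psi vm.
have psi_gt0 v : 0 < v -> 0 < psi v.
  by move=> v0; rewrite psiE ?(ltW v0)// powR_gt0// chi_gt0.
have c00 : 0 < c0 by rewrite divr_gt0// psi_gt0.
have psir v : 0 <= v -> psi v `^ r = chi v.
  by move=> v0; rewrite psiE// -powRrM mulVf ?gt_eqF// powRr1 ?chi_ge0.
have psi_ge0 v : 0 <= v -> 0 <= psi v by move=> v0; rewrite psiE// powR_ge0.
(* In terms of [v], the equation for [th] at [y] becomes [chi v = z y], equivalently
   [w y = c0 psi v]. *)
pose z y := (w y / c0) `^ r.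
have zE y v : a <= y -> y <= b -> 0 <= v -> chi v = z y -> w y = c0 * psi v.
  move=> ay yb v0; rewrite -psir// /z => /eqP.
  have wc0 : 0 <= w y / c0 by rewrite divr_ge0 ?(ltW c00) ?w0.
  move=> /eqP /(powR_injective r0); rewrite !nnegrE => -> //; last exact: psi_ge0.
  by field; rewrite gt_eqF.
have z0 : z y0 = chi vm.
  by rewrite /z /c0 invf_div mulrC divfK ?psir ?(ltW vm0)// gt_eqF.
have zmax y : a <= y -> y <= b -> z y <= chi vm.
  move=> ay yb; rewrite -z0; have wy := w0 y ay yb.
  apply: ler_powR_base (ltW r0) _ _; first by rewrite divr_ge0 ?(ltW c00).
  by rewrite ler_wpM2r ?invr_ge0 ?(ltW c00)// y0max// in_itv/= ay.
have rise y : exists v, a <= y -> y <= b -> [/\ 0 <= v, v <= vm & chi v = z y].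
  have [ay|] := boolP (a <= y); last by exists 0.
  have [yb|] := boolP (y <= b); last by exists 0.
  have chi0 : chi 0 = 0 by rewrite /chi mul0r.
  have [|v] := IVT (ltW vm0) (cchi 0 vm (lexx _)) (v := z y).
    rewrite chi0 min_l ?max_r ?chi_ge0 ?(ltW vm0)//.
    by rewrite powR_ge0 zmax.
  by rewrite in_itv/= => /andP[? ?] ?; exists v.
have fall y : exists v, y0 <= y -> y <= b -> vm <= v /\ chi v = z y.
  have [ay|] := boolP (y0 <= y); last by exists 0.
  have [yb|] := boolP (y <= b); last by exists 0.
  have Fy0 : 0 < F y0.
    rewrite lt_neqAle F0// andbT; apply/eqP => Fy0; move: wy0.
    by rewrite /w -Fy0 mul0r powR0 ?gt_eqF// mul0r ltxx.
  have Fy : 0 < F y by rewrite (lt_le_trans Fy0)// ndF.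
  have zy : 0 < z y by rewrite powR_gt0// divr_gt0// wpos// (le_trans ay0).
  (* A right end for the intermediate value theorem: [chi V <= V^(1-p) <= z y]. It requires
     [z y > 0], which holds after [y0] because [F] is nondecreasing and [F y0 > 0]. *)
  pose V := vm + z y `^ (1 - p)^-1.
  have V0 : 0 < z y `^ (1 - p)^-1 by rewrite powR_gt0.
  have vmV : vm <= V by rewrite lerDl ltW.
  have V00 : 0 < V by rewrite addr_gt0.
  have chiV : chi V <= z y.
    apply: (@le_trans _ _ (V `^ (1 - p))).
      rewrite /chi -{1}[V]powRr1 ?(ltW V00)//.
      rewrite powRD; last by apply/implyP => _; rewrite gt_eqF.
      by rewrite ler_wpM2l ?powR_ge0// ler_powRN_base ?(ltW p0)// lerDr.
    have -> : z y = (z y `^ (1 - p)^-1) `^ (1 - p).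
      by rewrite -powRrM mulVf ?powRr1 ?(ltW zy)// -opprB oppr_eq0 gt_eqF.
    have -> : 1 - p = - (p - 1) by ring.
    rewrite ler_powRN_base ?(ltW p10)// opprB; first exact: V0.
    by rewrite /V lerDr ltW.
  have [|v] := IVT vmV (cchi vm V (ltW vm0)) (v := z y).
    by rewrite ge_min le_max chiV zmax ?orbT// (le_trans ay0).
  by rewrite in_itv/= => /andP[? ?] ?; exists v.
have /choice [vr Hr] := rise.
have /choice [vf Hf] := fall.
pose A v x := (1 + v) `^ (1 - p) * x + c0 * (S 0 - S v).
pose th (v : R) := (1 + v)^-1.
have thE v : 0 <= v -> th v `^ (p - 1) = (1 + v) `^ (1 - p).
  move=> v0; rewrite /th -powR_inv1 ?addr_ge0//.
  by rewrite -powRrM; congr (_ `^ _); ring.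
pose kk := c0 `^ (- r).
have kkz y : a <= y -> y <= b -> kk * w y `^ r = z y.
  move=> ay yb; rewrite /z powRM ?w0 ?invr_ge0 ?(ltW c00)// mulrC; congr (_ * _).
  by rewrite /kk -powR_inv1 ?(ltW c00)// -powRrM mulN1r.
have thok y v : a <= y -> y <= b -> 0 <= v -> chi v = z y ->
    0 <= th v <= 1 /\ th v `^ (p - 1) * (1 - th v) = kk * w y `^ (q / p - 1).
  move=> ay yb v0 chiv; split.
    by rewrite invr_ge0 addr_ge0//= invf_le1 ?ltr_wpDr// lerDl.
  rewrite -/r kkz// -chiv thE// /chi /th.
  have -> : 1 - (1 + v)^-1 = v * (1 + v)^-1 by field; rewrite gt_eqF// ltr_wpDr.
  rewrite mulrCA -powR_inv1 ?addr_ge0//.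
  rewrite -powRD; first by congr (_ * (_ `^ _)); ring.
  by apply/implyP => _; rewrite gt_eqF// ltr_wpDr.
have kk0 : 0 <= kk by exact: powR_ge0.
have Hrise : A (vr y0) (w y0) - A (vr a) (w a) + kk * (p - 1) / k * (I y0 - I a) <= E y0 - E a.
  apply: (bliss_branch a y0 kk (fun y => A (vr y) (w y)) (fun y => th (vr y))) => //.
    move=> y ay yy0; have [v0 _ vz] := Hr y ay (le_trans yy0 y0b).
    exact: thok (le_trans yy0 y0b) v0 vz.
  move=> c d ac cd dy0; left.
  have [vc0 vcm vcz] := Hr c ac (le_trans cd (le_trans dy0 y0b)).
  have [vd0 vdm vdz] := Hr d (le_trans ac cd) (le_trans dy0 y0b).
  rewrite thE//.
  (* Envelope argument: [vr d] minimizes [A] at [w d]. Replacing it by [vr c] leaves two values of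
     one affine function of [w], with slope [th (vr c)^(p-1)]. *)
  suff : A (vr d) (w d) <= A (vr c) (w d) by rewrite /A; lra.
  rewrite /A (zE _ _ (le_trans ac cd) (le_trans dy0 y0b) vd0 vdz).
  set td := (1 + vr d) `^ _; set tc := (1 + vr c) `^ _.
  have : c0 * (S (vr c) - S (vr d)) <= c0 * (psi (vr d) * (tc - td)).
    rewrite ler_wpM2l ?(ltW c00)//.
    have [cd'|/ltW dc'] := leP (vr c) (vr d).
      by have /andP[] := Srise _ _ vc0 cd' vdm.
    by have /andP[] := Srise _ _ vd0 dc' vcm; rewrite -/tc -/td; lra.
  by lra.
have Hfall : A (vf b) (w b) - A (vf y0) (w y0) + kk * (p - 1) / k * (I b - I y0) <= E b - E y0.
  apply: (bliss_branch y0 b kk (fun y => A (vf y) (w y)) (fun y => th (vf y))) => //.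
    move=> y ay yb; have [vv vz] := Hf y ay yb.
    by apply: thok; rewrite ?(le_trans ay0)// (le_trans (ltW vm0)).
  move=> c d ac cd db; right.
  have [vc vcz] := Hf c ac (le_trans cd db).
  have [vd vdz] := Hf d (le_trans ac cd) db.
  have vc0 := le_trans (ltW vm0) vc; have vd0 := le_trans (ltW vm0) vd.
  rewrite thE//.
  (* Here the roots maximize [A], so the comparison is made at [w c] and the slope is taken at
     [d]. *)
  suff : A (vf d) (w c) <= A (vf c) (w c) by rewrite /A; lra.
  rewrite /A (zE _ _ (le_trans ay0 ac) (le_trans cd db) vc0 vcz).
  set td := (1 + vf d) `^ _; set tc := (1 + vf c) `^ _.
  have : c0 * (S (vf c) - S (vf d)) <= c0 * (psi (vf c) * (tc - td)).
    rewrite ler_wpM2l ?(ltW c00)//.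
    have [cd'|/ltW dc'] := leP (vf c) (vf d).
      by have /andP[] := Sfall _ _ vc cd'.
    by have /andP[] := Sfall _ _ vd dc'; rewrite -/tc -/td; lra.
  by lra.
(* [A] now telescopes through three comparisons: at [y0] both roots with [vm], at [a] the root with
   0, where [A 0 x = x], and at [b] with the limit [v -> +oo], encoded in [Stail]. *)
have Amid : A (vf y0) (w y0) <= A (vr y0) (w y0).
  have [v0 vm1 vz] := Hr y0 ay0 y0b.
  have [vm2 vz'] := Hf y0 (lexx _) y0b.
  have /andP[_ /(ler_wpM2l (ltW c00)) B1] := Srise _ _ v0 vm1 (lexx _).
  have /andP[_ /(ler_wpM2l (ltW c00)) B2] := Sfall _ _ (lexx _) vm2.
  have W := zE _ _ ay0 y0b (ltW vm0) (esym z0).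
  move: B1 B2; rewrite !mulrA -W /A.
  move: (_ `^ _) ((1 + vm) `^ _) ((1 + vf y0) `^ _) => t1 t2 t3; lra.
have Aa : A (vr a) (w a) <= w a.
  have [v0 vvm vz] := Hr a (lexx a) ab.
  rewrite /A {1}(zE _ _ _ _ v0 vz)//.
  have /andP[_ ] := Srise _ _ (lexx 0) v0 vvm.
  rewrite addr0 powR1 => /(ler_wpM2l (ltW c00)).
  by rewrite [X in _ -> _ <= X](zE _ _ _ _ v0 vz)//; lra.
have Ab : c0 * S 0 <= A (vf b) (w b).
  have [vv vz] := Hf b y0b (lexx b).
  have v0 := le_trans (ltW vm0) vv.
  rewrite /A (zE _ _ _ _ v0 vz)//.
  by have := Stail _ vv => /(ler_wpM2l (ltW c00)); lra.
apply: (@optimize_amplitude R r (S 0) c0 (E b)) => //; first exact: E0.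
have <- : kk * (p - 1) / k = c0 `^ (- r) / (r + 1).
  by rewrite /kk kE r1; field; rewrite !gt_eqF.
move: (kk * (p - 1) / k) Hrise Hfall => X Hrise Hfall.
move: Hrise Hfall Amid Aa Ab wE; lra.
Qed.

End bliss_core.

(** * Gamma and Beta integrals *)

Section gamma_beta.
Context (R : realType).
Local Notation mu := (@lebesgue_measure R).
Local Open Scope ereal_scope.

Definition gamma_fun (z x : R) : R := (x `^ (z - 1) * expR (- x))%R.

(** Kept in the extended reals so that Tonelli applies before finiteness is known; [Gamma z] is its
    [fine] part. *)
Definition egamma (z : R) : \bar R :=
  \int[mu]_(x in `]0%R, +oo[) (gamma_fun z x)%:E.

(** Euler's Beta function [B(be, al)] as an integral over the half-line. *)
Definition ebeta (al be : R) : \bar R :=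
  \int[mu]_(v in `]0%R, +oo[) (v `^ (be - 1) * (1 + v) `^ (- (al + be)))%:E.

Lemma gamma_fun_ge0 z x : (0 <= gamma_fun z x)%R.
Proof. by rewrite mulr_ge0 ?powR_ge0 ?expR_ge0. Qed.

Lemma measurable_gamma_fun z : measurable_fun setT (gamma_fun z).
Proof.
apply: measurable_funM => //.
by apply: measurableT_comp => //; exact: measurable_funN.
Qed.

(** The change of variables in [egamma_scale] asks for continuity up to 0. At [z = 1] it rests on
    the convention that [0] to the power [0] is 1. *)
Lemma continuous_gamma_fun (z : R) : (1 <= z)%R ->
  {within `[0%R, +oo[, continuous (gamma_fun z)}.
Proof.
move=> z1; rewrite /gamma_fun; apply/continuous_within_itvcyP; split.
  move=> x; rewrite in_itv/= andbT => x0; rewrite /continuous_at; apply: cvgM.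
    exact: continuous_powR.
  exact: continuous_expRN.
apply: cvgM.
  have [z1E|z1N] := eqVneq z 1%R.
    rewrite z1E subrr powRr0.
    rewrite (_ : (fun x : R => x `^ 0)%R = cst 1%R); first exact: cvg_cst.
    by apply/funext => x; rewrite powRr0.
  rewrite powR0 ?subr_eq0//; apply: powR_cvg0.
  by rewrite subr_gt0 lt_neqAle eq_sym z1N.
apply: cvg_at_right_filter; exact: continuous_expRN.
Qed.

Lemma egamma_scale (z c : R) : (1 <= z)%R -> (0 < c)%R ->
  \int[mu]_(x in `]0%R, +oo[) (x `^ (z - 1) * expR (- (c * x)))%:E =
  (c `^ (- z))%:E * egamma z.
Proof.
move=> z1 c0.
have mc : measurable_fun setT (fun x : R => x `^ (z - 1) * expR (- (c * x)))%R.
  apply: measurable_funM => //; apply: measurableT_comp => //.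
  by apply: measurable_funN; exact: measurable_funM.
have dF (x : R) : is_derive x 1%R ( *%R c) c.
  have := is_deriveM (is_derive_cst c x 1%R) (is_derive_id x (1%R : R)).
  by rewrite /= scaler0 addr0 [X in is_derive _ _ _ X]mulr1.
have dFE : (( *%R c)^`())%classic = cst c.
  by apply/funext => x; rewrite derive1E; exact: derive_val.
have := @increasing_ge0_integration_by_substitutiony R ( *%R c) (gamma_fun z) 0%R.
rewrite mulr0 dFE => H.
rewrite /egamma integral_itv_obnd_cbnd; last first.
  by apply/measurable_EFinP; exact: measurable_funTS.
rewrite integral_itv_obnd_cbnd; last first.
  by apply/measurable_EFinP; apply: measurable_funTS; exact: measurable_gamma_fun.
rewrite H; first last.
- by move=> x _; exact: gamma_fun_ge0.
- exact: continuous_gamma_fun.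
- exact: gt0_cvgMry.
- split; first by move=> x _; apply: ex_derive.
  by apply: cvg_at_right_filter; apply: differentiable_continuous; apply/derivable1_diffP; exact: ex_derive.
- exact: is_cvg_cst.
- exact: is_cvg_cst.
- by move=> x _; exact: cst_continuous.
- by move=> x y _ _; rewrite ltr_pM2l.
rewrite -ge0_integralZl//; last 3 first.
- apply/measurable_EFinP; apply: measurable_funTS; apply: measurable_funM => //.
  by apply: measurableT_comp; [exact: measurable_gamma_fun|exact: measurable_funM].
- by move=> x _; rewrite lee_fin mulr_ge0 ?gamma_fun_ge0 ?(ltW c0).
- by rewrite lee_fin powR_ge0.
apply: eq_integral => x; rewrite inE/= in_itv/= andbT => x0.
rewrite -EFinM /gamma_fun fctE /= powRM ?(ltW c0) ?(ltW x0)//; congr EFin.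
have -> : (c `^ (- z) * (c `^ (z - 1) * x `^ (z - 1) * expR (- (c * x)) * c) =
  (c * c `^ (z - 1) * c `^ (- z)) * (x `^ (z - 1) * expR (- (c * x))))%R by ring.
rewrite mulr_powRB1 ?(ltW c0)//; last lra.
by rewrite powRN divff ?mul1r// gt_eqF// powR_gt0.
Qed.

(* Tonelli for [v^(be-1) x^(al+be-1) exp (-(1+v)x)]. *)
Lemma egamma_beta (al be : R) : (1 <= be)%R -> (1 <= al + be)%R ->
  egamma (al + be) * ebeta al be = egamma be * egamma al.
Proof.
move=> be1; set s := (al + be)%R => s1.
pose D : set R := `]0%R, +oo[%classic.
have mD : measurable D by exact: measurable_itv.
have D0 x : x \in D -> (0 < x)%R by rewrite inE /D/= in_itv/= andbT.
pose h (v x : R) : R := (v `^ (be - 1) * x `^ (s - 1) * expR (- ((1 + v) * x)))%R.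
pose f (z : R * R) : \bar R := (\1_D z.1 * \1_D z.2 * h z.1 z.2)%:E.
have mf : measurable_fun setT f.
  apply/measurable_EFinP; apply: measurable_funM.
    by apply: measurable_funM; apply: (measurableT_comp (f := \1_D : R -> R)).
  apply: measurable_funM.
    apply: measurable_funM.
      by apply: (measurableT_comp (@measurable_powR R (be - 1)%R)).
    by apply: (measurableT_comp (@measurable_powR R (s - 1)%R)).
  apply: measurableT_comp => //; apply: measurable_funN; apply: measurable_funM => //.
  exact: measurable_funD.
have f0 z : 0 <= f z by rewrite lee_fin !mulr_ge0 ?powR_ge0 ?expR_ge0.
have gamma_ge0 z : 0 <= egamma z.
  by apply: integral_ge0 => x _; rewrite lee_fin gamma_fun_ge0.
have mE c : measurable_fun setT (fun x : R => expR (- (c * x))).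
  by apply: measurableT_comp => //; apply: measurable_funN; exact: measurable_funM.
have innerx v : \int[mu]_x f (v, x) =
    ((fun v => (v `^ (be - 1) * (1 + v) `^ (- s))%:E * egamma s) \_ D) v.
  rewrite patchE; case: ifPn => vD; last first.
    by apply: integral0_eq => x _; rewrite /f/= indicE (negbTE vD) !mul0r.
  have v0 := D0 _ vD.
  transitivity (\int[mu]_(x in D) ((v `^ (be - 1))%:E *
      (x `^ (s - 1) * expR (- ((1 + v) * x)))%:E)).
    rewrite [RHS]integral_mkcond; apply: eq_integral => x _.
    rewrite /f/= !indicE vD patchE; case: (x \in D); last by rewrite mulr0 mul0r.
    by rewrite !mul1r -EFinM /h mulrA.
  rewrite ge0_integralZl_EFin ?powR_ge0//; last 2 first.
  - by move=> x _; rewrite lee_fin mulr_ge0 ?powR_ge0 ?expR_ge0.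
  - by apply/measurable_EFinP/measurable_funTS; apply: measurable_funM => //; exact: mE.
  rewrite egamma_scale//; last by rewrite addr_gt0.
  by rewrite muleA EFinM.
have innerv x : \int[mu]_v f (v, x) =
    ((fun x => (gamma_fun al x)%:E * egamma be) \_ D) x.
  rewrite patchE; case: ifPn => xD; last first.
    by apply: integral0_eq => v _; rewrite /f/= !indicE (negbTE xD) mulr0 !mul0r.
  have x0 := D0 _ xD.
  transitivity (\int[mu]_(v in D) ((x `^ (s - 1) * expR (- x))%:E *
      (v `^ (be - 1) * expR (- (x * v)))%:E)).
    rewrite [RHS]integral_mkcond; apply: eq_integral => v _.
    rewrite /f/= !indicE xD patchE; case: (v \in D); last by rewrite !mul0r.
    rewrite !mul1r -EFinM /h mulrDl mul1r opprD expRD; congr EFin.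
    by rewrite [(x * v)%R]mulrC; ring.
  rewrite ge0_integralZl_EFin ?mulr_ge0 ?powR_ge0 ?expR_ge0//; last 2 first.
  - by move=> v _; rewrite lee_fin mulr_ge0 ?powR_ge0 ?expR_ge0.
  - by apply/measurable_EFinP/measurable_funTS; apply: measurable_funM => //; exact: mE.
  rewrite egamma_scale// muleA -EFinM; congr (_%:E * _).
  rewrite mulrAC -powRD; last by apply/implyP => _; rewrite gt_eqF.
  by congr (_ `^ _ * _)%R; rewrite /s; ring.
have := @fubini_tonelli _ _ _ _ R mu mu f mf f0.
under eq_integral do rewrite innerx.
under [in RHS]eq_integral do rewrite innerv.
rewrite -!integral_mkcond /=.
rewrite ge0_integralZr//; last 2 first.
- apply/measurable_EFinP/measurable_funTS; apply: measurable_funM => //.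
  by apply: (measurableT_comp (@measurable_powR R (- s)%R)); exact: measurable_funD.
- by move=> x _; rewrite lee_fin mulr_ge0 ?powR_ge0.
rewrite ge0_integralZr; first last.
- exact: gamma_ge0.
- by move=> x _; rewrite lee_fin gamma_fun_ge0.
- by apply/measurable_EFinP/measurable_funTS; exact: measurable_gamma_fun.
- exact: mD.
by rewrite muleC => ->; rewrite muleC.
Qed.

End gamma_beta.

(** * Finiteness, positivity and functional equation of Gamma *)

Section gamma_finite.
Context (R : realType).
Local Notation mu := (@lebesgue_measure R).
Local Open Scope ereal_scope.

Lemma integral_powR1D_tail (s v : R) : (0 < s)%R -> (0 <= v)%R ->
  \int[mu]_(t in `[v, +oo[) (s * (1 + t) `^ (- (s + 1)))%:E =
  ((1 + v) `^ (- s))%:E.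
Proof.
move=> s0 v0.
pose F (t : R) : R := (- (1 + t) `^ (- s))%R.
have dF (x : R) : (-1 < x)%R -> is_derive x 1%R F (s * (1 + x) `^ (- (s + 1)))%R.
  move=> x1; have := is_deriveN (is_derive_powR1D R (- s) x x1).
  by rewrite mulNr opprK opprD.
rewrite (@ge0_continuous_FTC2y R _ F v 0%R); first by rewrite /F EFinN oppeK add0e.
- by move=> x _; rewrite mulr_ge0 ?powR_ge0 ?(ltW s0).
- apply: continuous_in_subspaceT => x; rewrite inE/= in_itv/= andbT => vx.
  rewrite /continuous_at; apply: cvgM; first exact: cvg_cst.
  by apply: continuous_powR1D; lra.
- rewrite -oppr0; apply: cvgN; apply/cvgrPdist_le => e e0.
  near=> t.
  have t0 : (0 <= t)%R by near: t; exact: nbhs_pinfty_ge.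
  have et : (e `^ (- s^-1) <= 1 + t)%R.
    have : (e `^ (- s^-1) <= t)%R by near: t; exact: nbhs_pinfty_ge.
    lra.
  rewrite sub0r normrN ger0_norm ?powR_ge0//.
  have -> : e = ((e `^ (- s^-1)) `^ (- s))%R.
    by rewrite -powRrM mulrNN mulVf ?powRr1 ?(ltW e0)// gt_eqF.
  by rewrite ler_powRN_base ?powR_gt0 ?(ltW s0).
- by move=> x vx; apply: ex_derive; apply: dF; lra.
- apply: cvg_at_right_filter; apply: differentiable_continuous.
  by apply/derivable1_diffP; apply: ex_derive; apply: dF; lra.
- move=> x; rewrite in_itv/= andbT => vx; rewrite derive1E.
  by have xd := dF x ltac:(lra); exact: derive_val.
Unshelve. all: by end_near. Qed.

Lemma egamma1 : egamma R 1 = 1.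
Proof.
pose F (x : R) : R := (- expR (- x))%R.
have dF (x : R) : is_derive x 1%R F (expR (- x)).
  have := is_deriveN (is_derive1_comp (is_derive_expR (- x)) (is_deriveN (is_derive_id x (1%R : R)))).
  by rewrite mulrN1 opprK.
transitivity (\int[mu]_(x in `[0%R, +oo[) (expR (- x))%:E).
  rewrite -integral_itv_obnd_cbnd.
    by apply: eq_integral => x _; rewrite /gamma_fun subrr powRr0 mul1r.
  by apply/measurable_EFinP/measurable_funTS/measurableT_comp => //; exact: measurable_funN.
rewrite (@ge0_continuous_FTC2y R _ F 0%R 0%R).
- by rewrite /F oppr0 expR0 EFinN oppeK add0e.
- by move=> x _; exact: expR_ge0.
- by apply: continuous_subspaceT; exact: continuous_expRN.
- by rewrite -oppr0; apply: cvgN; exact: cvgr_expR.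
- by move=> x _; apply: ex_derive.
- apply: cvg_at_right_filter; apply: differentiable_continuous.
  by apply/derivable1_diffP; apply: ex_derive.
- by move=> x _; rewrite derive1E; exact: derive_val.
Qed.

Lemma egamma_ge0 (z : R) : 0 <= egamma R z.
Proof. by apply: integral_ge0 => x _; rewrite lee_fin gamma_fun_ge0. Qed.

Lemma egamma_gt0 (z : R) : 0 < egamma R z.
Proof.
(* On [[1, 2]], [0 <= ln x <= 2] and [x <= 2], so [c] bounds [gamma_fun z] from below. *)
pose c : R := expR (- (`|z - 1| * 2) - 2)%R.
apply: (@lt_le_trans _ _ (\int[mu]_(x in `[1%R, 2%R]) c%:E)).
  rewrite integral_cst//= lebesgue_measure_itv/= lte_fin ltr1n -EFinB -EFinM lte_fin.
  by rewrite mulr_gt0 ?expR_gt0//; lra.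
apply: (@le_trans _ _ (\int[mu]_(x in `[1%R, 2%R]) (gamma_fun R z x)%:E)).
  apply: ge0_le_integral => //.
  - by move=> x _; rewrite lee_fin expR_ge0.
  - by apply/measurable_EFinP/measurable_funTS; exact: measurable_gamma_fun.
  - move=> x /=; rewrite in_itv/= => /andP[x1 x2]; rewrite lee_fin.
    rewrite /gamma_fun /powR gt_eqF; last lra.
    rewrite -expRD ler_expR lerD//; last lra.
    have l0 : (0 <= ln x)%R by exact: ln_ge0.
    have l2 : (ln x <= 2)%R by have := @ln_sublinear R x ltac:(lra); lra.
    have z0 : (0 <= `|z - 1|)%R by [].
    have : (- `|z - 1| <= z - 1)%R by rewrite lerNl ler_normr lexx orbT.
    nra.
apply: ge0_subset_integral => //.
- by apply/measurable_EFinP/measurable_funTS; exact: measurable_gamma_fun.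
- by move=> x _; rewrite lee_fin gamma_fun_ge0.
- by move=> x /=; rewrite !in_itv/= andbT => /andP[x1 _]; exact: lt_le_trans ltr01 x1.
Qed.

Lemma egamma_lty (z : R) : (1 <= z)%R -> egamma R z < +oo.
Proof.
move=> z1.
pose m : R := (z - 1)%R.
(* Half of the exponential decay absorbs the power: [ln t <= t] at [t = x/(2m)] gives
   [C = (2m)^m]. *)
have [C C0 HC] : exists2 C : R, (0 <= C)%R &
    forall x, (0 < x)%R -> (x `^ m <= C * expR (x / 2))%R.
  have m0 : (0 <= m)%R by rewrite /m; lra.
  move: m0; rewrite le_eqVlt => /predU1P[<-|m0].
    exists 1%R => // x x0; rewrite powRr0 mul1r (le_trans _ (expR_ge1Dx _))//; lra.
  exists (expR (m * ln (2 * m))); first exact: expR_ge0.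
  move=> x x0; rewrite /powR gt_eqF// -expRD ler_expR.
  have xm : (0 < x / (2 * m))%R by rewrite divr_gt0//; lra.
  have := @ln_sublinear R _ xm.
  rewrite ln_div ?posrE//; last lra.
  move=> H.
  have -> : (x / 2 = m * (x / (2 * m)))%R by field; lra.
  by rewrite -mulrDr ler_pM2l//; lra.
have mE (c : R) : measurable_fun setT (fun x : R => expR (- (c * x))).
  by apply: measurableT_comp => //; apply: measurable_funN; exact: measurable_funM.
apply: (@le_lt_trans _ _ (\int[mu]_(x in `]0%R, +oo[)
    (C%:E * (x `^ (1 - 1) * expR (- (2^-1 * x)))%:E))).
  apply: ge0_le_integral => //.
  - by move=> x _; rewrite lee_fin gamma_fun_ge0.
  - by apply/measurable_EFinP/measurable_funTS; exact: measurable_gamma_fun.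
  - apply/measurable_EFinP/measurable_funTS; apply: measurable_funM => //.
    by apply: measurable_funM => //; exact: mE.
  - move=> x /=; rewrite in_itv/= andbT => x0; rewrite -EFinM lee_fin subrr powRr0 mul1r.
    have /(ler_wpM2r (expR_ge0 (- x))) := HC x x0.
    rewrite -mulrA -expRD /gamma_fun -/m; congr (_ <= _ * expR _)%R; lra.
rewrite ge0_integralZl_EFin//; last 2 first.
- by move=> x _; rewrite lee_fin mulr_ge0 ?powR_ge0 ?expR_ge0.
- by apply/measurable_EFinP/measurable_funTS; apply: measurable_funM => //; exact: mE.
by rewrite egamma_scale// egamma1 mule1 -EFinM ltry.
Qed.

(** No integration by parts: this is the case [be = 1] of [egamma_beta], where the Beta integral is
    elementary and equals [1/al]. *)
Lemma egammaS (al : R) : (0 < al)%R -> egamma R (al + 1) = al%:E * egamma R al.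
Proof.
move=> al0.
have := egamma_beta R al 1 (lexx _) ltac:(lra).
rewrite egamma1 mul1e => <-.
rewrite muleA [al%:E * _]muleC -muleA.
have -> : al%:E * ebeta R al 1 = 1.
  rewrite /ebeta -ge0_integralZl_EFin ?(ltW al0)//; last 2 first.
  - by move=> x _; rewrite lee_fin mulr_ge0 ?powR_ge0.
  - apply/measurable_EFinP/measurable_funTS; apply: measurable_funM => //.
    by apply: (measurableT_comp (@measurable_powR R (- (al + 1))%R)); exact: measurable_funD.
  have := integral_powR1D_tail al 0 al0 (lexx _).
  rewrite addr0 powR1 => <-; rewrite -integral_itv_obnd_cbnd.
    by apply: eq_integral => x _; rewrite subrr powRr0 mul1r -EFinM.
  apply/measurable_EFinP/measurable_funTS; apply: measurable_funM => //.
  by apply: (measurableT_comp (@measurable_powR R (- (al + 1))%R)); exact: measurable_funD.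
by rewrite mule1.
Qed.

Lemma GammaE (z : R) : Gamma z = fine (egamma R z).
Proof. by []. Qed.

Lemma Gamma_gt0 (z : R) : (1 <= z)%R -> (0 < Gamma z)%R.
Proof. by move=> z1; rewrite GammaE fine_gt0// egamma_gt0 egamma_lty. Qed.

(** The factor [al] turns [Gamma al] into [Gamma (al + 1)], which [egamma_lty] controls even when
    [al < 1]; it is also the form in which the constant of Bliss appears. *)
Lemma Gamma_beta (al be : R) : (0 < al)%R -> (1 <= be)%R -> (1 <= al + be)%R ->
  (al%:E * ebeta R al be =
   (Gamma be * Gamma (al + 1) / Gamma (al + be))%:E).
Proof.
move=> al0 be1 s1.
have fin z : (1 <= z)%R -> egamma R z = (Gamma z)%:E.
  by move=> z1; rewrite GammaE fineK// ge0_fin_numE ?egamma_ge0 ?egamma_lty.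
have gs := Gamma_gt0 _ s1.
have E := egamma_beta R al be be1 s1.
have al1 : (1 <= al + 1)%R by lra.
have Ea : al%:E * egamma R al = (Gamma (al + 1))%:E by rewrite -egammaS// fin.
move: E; rewrite (fin _ s1) (fin _ be1) => E.
have -> : (Gamma be * Gamma (al + 1) / Gamma (al + be))%:E =
   (Gamma (al + be))^-1%:E * ((Gamma be)%:E * (al%:E * egamma R al)).
  by rewrite Ea -!EFinM mulrC.
rewrite [(Gamma be)%:E * _]muleCA -E !muleA.
rewrite -!EFinM; congr (_%:E * _).
by field; rewrite gt_eqF.
Qed.

End gamma_finite.

(** * The weight [psi] and its tail integral *)

Section slope_integral.
Context (R : realType) (p r : R).
Hypotheses (p1 : 1 < p) (r0 : 0 < r).
Local Notation mu := (@lebesgue_measure R).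

Let vm := (p - 1)^-1.
Let p10 : 0 < p - 1. Proof. by rewrite subr_gt0. Qed.
Let p0 : 0 < p. Proof. exact: lt_trans ltr01 p1. Qed.
Let vm0 : 0 < vm. Proof. by rewrite invr_gt0. Qed.

Definition slope_weight (v : R) : R := (v * (1 + v) `^ (- p)) `^ r^-1.
Local Notation psi := slope_weight.

Lemma slope_weight_ge0 v : 0 <= psi v. Proof. exact: powR_ge0. Qed.
Local Hint Resolve slope_weight_ge0 : core.

(** The tangent of [x^p] at [1 + v] replaces differentiation: what remains factors as
    [(1+v)^(p-1) (v-u) (1-(p-1)v)], which shows why the peak is at [vm]. *)
Lemma slope_weight_homo u v : 0 <= u -> u <= v -> v <= vm -> psi u <= psi v.
Proof.
move=> u0 uv vvm; have v0 := le_trans u0 uv.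
have u1 : 0 < 1 + u by rewrite ltr_wpDr.
have v1 : 0 < 1 + v by rewrite ltr_wpDr.
apply: ler_powR_base; rewrite ?invr_ge0 ?(ltW r0) ?mulr_ge0 ?powR_ge0//.
rewrite !powRN ler_pdivrMr ?powR_gt0// mulrAC ler_pdivlMr ?powR_gt0//.
have tan := powR_tangent R p (1 + v) (1 + u) p1 (ltW v1) (ltW u1).
have E : (1 + v) `^ p = (1 + v) `^ (p - 1) * (1 + v).
  by rewrite mulrC mulr_powRB1 ?(ltW v1).
have vp : (p - 1) * v <= 1 by rewrite mulrC -ler_pdivlMr// mul1r.
have c0 : 0 <= (1 + v) `^ (p - 1) by exact: powR_ge0.
move/(ler_wpM2l v0): tan; rewrite E; apply: le_trans.
rewrite -subr_ge0; move: (_ `^ (p - 1)) c0 => c c0.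
rewrite (_ : _ - _ = c * ((v - u) * (1 - (p - 1) * v))); last by ring.
by rewrite mulr_ge0// mulr_ge0// subr_ge0.
Qed.

Lemma slope_weight_nhomo u v : vm <= u -> u <= v -> psi v <= psi u.
Proof.
move=> vmu uv; have u0 := le_trans (ltW vm0) vmu; have v0 := le_trans u0 uv.
have u1 : 0 < 1 + u by rewrite ltr_wpDr.
have v1 : 0 < 1 + v by rewrite ltr_wpDr.
apply: ler_powR_base; rewrite ?invr_ge0 ?(ltW r0) ?mulr_ge0 ?powR_ge0//.
rewrite !powRN ler_pdivrMr ?powR_gt0// mulrAC ler_pdivlMr ?powR_gt0//.
have tan := powR_tangent R p (1 + u) (1 + v) p1 (ltW u1) (ltW v1).
have E : (1 + u) `^ p = (1 + u) `^ (p - 1) * (1 + u).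
  by rewrite mulrC mulr_powRB1 ?(ltW u1).
have up : 1 <= (p - 1) * u by rewrite mulrC -ler_pdivrMr// mul1r.
have c0 : 0 <= (1 + u) `^ (p - 1) by exact: powR_ge0.
move/(ler_wpM2l u0): tan; rewrite E; apply: le_trans.
rewrite -subr_ge0; move: (_ `^ (p - 1)) c0 => c c0.
rewrite (_ : _ - _ = c * ((v - u) * ((p - 1) * u - 1))); last by ring.
by rewrite mulr_ge0// mulr_ge0// subr_ge0.
Qed.

Lemma slope_weight_max v : 0 <= v -> psi v <= psi vm.
Proof.
move=> v0; have [vvm|/ltW vmv] := leP v vm; first exact: slope_weight_homo.
exact: slope_weight_nhomo.
Qed.

Let m (t : R) : R := (p - 1) * (1 + t) `^ (- p).

Let m_ge0 t : 0 <= m t.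
Proof. by rewrite mulr_ge0 ?powR_ge0 ?(ltW p10). Qed.

Let measurable_m : measurable_fun setT m.
Proof.
apply: measurable_funM => //.
by apply: (measurableT_comp (@measurable_powR R (- p))); exact: measurable_funD.
Qed.

Let measurable_psi : measurable_fun setT psi.
Proof.
apply: (measurableT_comp (@measurable_powR R r^-1)).
apply: measurable_funM => //.
by apply: (measurableT_comp (@measurable_powR R (- p))); exact: measurable_funD.
Qed.

Let measurable_psim : measurable_fun setT (fun t => psi t * m t).
Proof. exact: measurable_funM. Qed.

(** The [S] of [bliss_core]: [m] is the density of [d(- (1+t)^(1-p))]. *)
Definition slope_tail (v : R) : R :=
  fine (\int[mu]_(t in `[v, +oo[) (psi t * m t)%:E)%E.

Let integral_m v : 0 <= v ->
  (\int[mu]_(t in `[v, +oo[) (m t)%:E = ((1 + v) `^ (1 - p))%:E)%E.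
Proof.
by move=> v0; have := integral_powR1D_tail R (p - 1) v p10 v0; rewrite subrK opprB.
Qed.

Let integral_split (g : R -> R) u v : measurable_fun setT g -> (forall t, 0 <= g t) ->
  u <= v -> (\int[mu]_(t in `[u, +oo[) (g t)%:E =
  \int[mu]_(t in `[u, v[) (g t)%:E + \int[mu]_(t in `[v, +oo[) (g t)%:E)%E.
Proof.
move=> mg g0 uv; rewrite -ge0_integral_setU//=.
- congr (integral _ _ _); rewrite -itv_bndbnd_setU//=; rewrite bnd_simp//.
- by apply/measurable_EFinP; exact: measurable_funTS.
- by move=> x _; rewrite lee_fin.
- apply/disj_setPS => x/= []; rewrite !in_itv/= andbT => /andP[_ xv] vx.
  by move: (lt_le_trans xv vx); rewrite ltxx.
Qed.

Let integral_psim_le v c : 0 <= v -> 0 <= c -> (forall t, v <= t -> psi t <= c) ->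
  (\int[mu]_(t in `[v, +oo[) (psi t * m t)%:E <= (c * (1 + v) `^ (1 - p))%:E)%E.
Proof.
move=> v0 c0 H; rewrite EFinM -integral_m// -ge0_integralZl_EFin//; last 2 first.
- by move=> x _; rewrite lee_fin.
- by apply/measurable_EFinP/measurable_funTS.
apply: ge0_le_integral => //.
- by move=> x _; rewrite lee_fin mulr_ge0.
- by apply/measurable_EFinP/measurable_funTS.
- by apply/measurable_EFinP/measurable_funTS/measurable_funM.
- move=> x /=; rewrite in_itv/= andbT => vx.
  by rewrite -EFinM lee_fin ler_wpM2r// H.
Qed.

Let slope_tail_fin v : 0 <= v ->
  (\int[mu]_(t in `[v, +oo[) (psi t * m t)%:E)%E = (slope_tail v)%:E.
Proof.
move=> v0; rewrite /slope_tail fineK// ge0_fin_numE; last first.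
  by apply: integral_ge0 => x _; rewrite lee_fin mulr_ge0.
apply: (@le_lt_trans _ _ (psi vm * (1 + v) `^ (1 - p))%:E); last exact: ltry.
apply: (integral_psim_le v (psi vm) v0 (slope_weight_ge0 vm)) => t vt.
exact: slope_weight_max (le_trans v0 vt).
Qed.

Lemma slope_tail_le v : vm <= v -> slope_tail v <= psi v * (1 + v) `^ (1 - p).
Proof.
move=> vmv; have v0 := le_trans (ltW vm0) vmv.
rewrite -lee_fin -(slope_tail_fin v v0).
apply: (integral_psim_le v (psi v) v0 (slope_weight_ge0 v)) => t vt.
exact: slope_weight_nhomo.
Qed.

(** The integral of [m] over [[u, v[] is the difference of powers. With [psi] monotone, its end
    values serve as [lo] and [hi] and give the hypotheses on [S] in [bliss_core]. *)
Lemma slope_tail_diff u v lo hi : 0 <= u -> u <= v -> 0 <= lo -> 0 <= hi ->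
  (forall t, u <= t -> t < v -> lo <= psi t <= hi) ->
  lo * ((1 + u) `^ (1 - p) - (1 + v) `^ (1 - p)) <= slope_tail u - slope_tail v <=
  hi * ((1 + u) `^ (1 - p) - (1 + v) `^ (1 - p)).
Proof.
move=> u0 uv lo0 hi0 H; have v0 := le_trans u0 uv.
have := integral_split _ _ _ measurable_psim (fun t => mulr_ge0 (slope_weight_ge0 t) (m_ge0 t)) uv.
have := integral_split _ _ _ measurable_m m_ge0 uv.
rewrite !integral_m// !slope_tail_fin//.
set Jm := (\int[mu]_(t in `[u, v[) (m t)%:E)%E; set J := (\int[mu]_(t in `[u, v[) _)%E.
have Jm0 : (0 <= Jm)%E by apply: integral_ge0 => x _; rewrite lee_fin.
have J0 : (0 <= J)%E by apply: integral_ge0 => x _; rewrite lee_fin mulr_ge0.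
have loJ : (lo%:E * Jm <= J)%E.
  rewrite -ge0_integralZl_EFin//; last 2 first.
  - by move=> x _; rewrite lee_fin.
  - by apply/measurable_EFinP/measurable_funTS.
  apply: ge0_le_integral => //.
  - by move=> x _; rewrite -EFinM lee_fin mulr_ge0.
  - by apply/measurable_EFinP/measurable_funTS/measurable_funM.
  - by apply/measurable_EFinP/measurable_funTS.
  - move=> x /=; rewrite in_itv/= => /andP[ux xv].
    by rewrite -EFinM lee_fin ler_wpM2r//; have /andP[] := H _ ux xv.
have hiJ : (J <= hi%:E * Jm)%E.
  rewrite -ge0_integralZl_EFin//; last 2 first.
  - by move=> x _; rewrite lee_fin.
  - by apply/measurable_EFinP/measurable_funTS.
  apply: ge0_le_integral => //.
  - by move=> x _; rewrite lee_fin mulr_ge0.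
  - by apply/measurable_EFinP/measurable_funTS.
  - by apply/measurable_EFinP/measurable_funTS/measurable_funM.
  - move=> x /=; rewrite in_itv/= => /andP[ux xv].
    by rewrite -EFinM lee_fin ler_wpM2r//; have /andP[] := H _ ux xv.
move: Jm J Jm0 J0 loJ hiJ => [jm| |] [j| |]// _ _.
rewrite -!EFinM !lee_fin => loJ hiJ; rewrite -!EFinD => -[->] [->].
by rewrite !addrK loJ hiJ.
Qed.

(** [psi m] is [p-1] times the Beta integrand with [be = 1 + 1/r] and [al = (p-1)(1 + 1/r)]; the
    prefactor comes from [p-1 = al r/(r+1)]. *)
Lemma slope_tail0 : slope_tail 0 = r / (r + 1) *
  (Gamma (1 + r^-1) * Gamma ((p - 1) * (1 + r^-1) + 1) / Gamma (p * (1 + r^-1))).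
Proof.
pose al := (p - 1) * (1 + r^-1); pose be := 1 + r^-1.
have be1 : 1 <= be by rewrite lerDl invr_ge0 ltW.
have al0 : 0 < al by rewrite mulr_gt0// ltr_wpDr// invr_ge0 ltW.
have albe : al + be = p * (1 + r^-1) by rewrite /al /be; ring.
have s1 : 1 <= al + be by rewrite (le_trans be1)// lerDr ltW.
have B := Gamma_beta R al be al0 be1 s1.
apply: EFin_inj; rewrite -slope_tail_fin// -integral_itv_obnd_cbnd; last first.
  by apply/measurable_EFinP/measurable_funTS.
transitivity ((p - 1)%:E * ebeta R al be)%E.
  rewrite -ge0_integralZl_EFin; first last.
  - exact: ltW p10.
  - apply/measurable_EFinP/measurable_funTS; apply: measurable_funM => //.
    by apply: (measurableT_comp (@measurable_powR R (- (al + be)))); exact: measurable_funD.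
  - by move=> x _; rewrite lee_fin mulr_ge0 ?powR_ge0.
  - exact: measurable_itv.
  apply: eq_integral => t; rewrite inE/= in_itv/= andbT => t0.
  have t1 : 0 < 1 + t by rewrite addr_gt0.
  rewrite -EFinM; congr EFin.
  rewrite /psi powRM ?powR_ge0 ?(ltW t0)// -powRrM /m mulrCA; congr (_ * _).
  rewrite -mulrA -powRD; last by apply/implyP => _; rewrite gt_eqF.
  rewrite albe; congr (_ `^ _ * _ `^ _); first by rewrite /be; ring.
  by ring.
have -> : (p - 1)%:E = ((r / (r + 1))%:E * al%:E)%E.
  rewrite -EFinM; congr EFin; rewrite /al; field.
  by rewrite !gt_eqF// addr_gt0.
by rewrite -muleA B -albe.
Qed.

Lemma slope_tail0_gt0 : 0 < slope_tail 0.
Proof.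
have r1 : 0 < r + 1 by rewrite addr_gt0.
have rV : 0 < r^-1 by rewrite invr_gt0.
have h : 1 <= 1 + r^-1 by rewrite lerDl ltW.
rewrite slope_tail0 mulr_gt0 ?divr_gt0 ?mulr_gt0 ?Gamma_gt0//.
  by rewrite lerDr mulr_ge0 ?(ltW p10)// (le_trans _ h).
by rewrite (le_trans h)// ler_peMl ?(ltW p1)// (le_trans _ h).
Qed.

End slope_integral.

(** * The constants of Hardy and Bliss *)

Lemma conj_expE (R : realType) (p : R) : 1 < p -> conj_exp p = p / (p - 1).
Proof.
move=> p1; have := conj_expP p1 => /(canRL (addKr _)) E.
by rewrite -[conj_exp p]invrK E; field; lra.
Qed.

(** Dictionary: [q/s = r], [s = p(1 + 1/r) = al + be], [s/p = be] and [s/q' = al + 1], with the [al]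
    and [be] of [slope_tail0]. *)
Lemma bliss_const_powR (R : realType) (p q : R) : 1 < p -> p < q ->
  let r := q / p - 1 in
  bliss_const p q `^ q = (r / ((r + 1) * slope_tail R p r 0)) `^ r.
Proof.
move=> p1 pq r.
have p0 : 0 < p by lra.
have q0 : 0 < q by lra.
have r0 : 0 < r by rewrite /r subr_gt0 ltr_pdivlMr// mul1r.
rewrite /bliss_const lt_eqF// slope_tail0// conj_expE; last lra.
set s := (p^-1 - q^-1)^-1.
have sE : s = p * (1 + r^-1).
  by rewrite /s /r; field; rewrite ?gt_eqF//= ?subr_gt0 ?mulr_gt0//; lra.
have rq : s^-1 * q = r by rewrite invrK /r; field; lra.
rewrite -powRrM rq -sE.
have -> : s / p = 1 + r^-1 by rewrite sE; field; lra.
have -> : s / (q / (q - 1)) = (p - 1) * (1 + r^-1) + 1.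
  by rewrite sE /r; field; rewrite ?gt_eqF//= ?subr_gt0 ?mulr_gt0//; lra.
have rV : 0 < r^-1 by rewrite invr_gt0.
have h : 1 <= 1 + r^-1 by lra.
have G1 := Gamma_gt0 R _ h.
have h2 : 1 <= (p - 1) * (1 + r^-1) + 1 by rewrite lerDr mulr_ge0//; lra.
have G2 := Gamma_gt0 R _ h2.
have h3 : 1 <= s by rewrite sE (le_trans h)// ler_peMl ?(ltW p1)// (le_trans _ h).
have G3 := Gamma_gt0 R _ h3.
have r1 : 0 < r + 1 by rewrite addr_gt0.
congr (_ `^ _); move: (Gamma _) (Gamma _) (Gamma _) G1 G2 G3 => g1 g2 g3 G1 G2 G3.
by field; rewrite !gt_eqF.
Qed.

Lemma bliss_const_gt0 (R : realType) (p q : R) : 1 < p -> p <= q ->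
  0 < bliss_const p q.
Proof.
move=> p1; rewrite le_eqVlt => /predU1P[<-|pq].
  rewrite /bliss_const eqxx conj_expE// mulr_gt0// powR_gt0//; first lra.
  by rewrite divr_gt0//; lra.
have q0 : 0 < q by lra.
have r0 : 0 < q / p - 1 by rewrite subr_gt0 ltr_pdivlMr ?mul1r//; lra.
have K0 : 0 <= bliss_const p q.
  by rewrite /bliss_const lt_eqF// powR_ge0.
apply: (gt0_powR q0 K0); rewrite bliss_const_powR// powR_gt0// divr_gt0//.
by rewrite mulr_gt0 ?slope_tail0_gt0// addr_gt0.
Qed.

Lemma truncated_bliss (R : realType) (p q a b : R) (F E I : R -> R) :
  1 < p -> p <= q -> 0 < a -> a <= b -> 0 <= F a ->
  (forall c d, a <= c -> c <= d -> d <= b -> F c <= F d) ->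
  (forall g c d, 0 <= g -> a <= c -> c <= d -> d <= b ->
    p * g `^ (p - 1) * (F d - F c) - (p - 1) * g `^ p * (d - c) <= E d - E c) ->
  (forall c d, a <= c -> c <= d -> d <= b ->
    I d - I c <= F d `^ q * (c `^ (- (q - q / p)) - d `^ (- (q - q / p)))) ->
  (F a / a) `^ p * a <= E a -> 0 <= E b ->
  I b - I a <= bliss_const p q `^ q * E b `^ (q / p).
Proof.
move=> p1 pq a0 ab Fa ndF EF IF Ea Eb; have p0 : 0 < p by lra.
move: (pq); rewrite le_eqVlt => /predU1P[pqE|ltpq].
  have := @hardy_core R p q a b F E I p1 pq a0 ab Fa ndF EF IF pqE Ea.
  rewrite -pqE divff ?gt_eqF// powRr1// /bliss_const eqxx conj_expE//.
  rewrite (@powRM _ (p `^ p^-1)) ?powR_ge0// -!powRrM mulVf ?gt_eqF//.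
  by rewrite powRr1 ?(ltW p0)// invf_div divfK// gt_eqF.
rewrite bliss_const_powR//.
have r0 : 0 < q / p - 1 by rewrite subr_gt0 ltr_pdivlMr ?mul1r.
have cF := @bliss_primitive_continuous R p a b F E p1 a0 ab ndF EF.
apply: (@bliss_core R p q a b F E I p1 pq a0 ab Fa ndF EF IF
  (slope_tail R p (q / p - 1)) (slope_weight R p (q / p - 1))) => //.
- move=> u v u0 uv vvm; have v0 := le_trans u0 uv.
  apply: slope_tail_diff => //; try exact: slope_weight_ge0.
  move=> t ut /ltW tv; apply/andP; split.
    by apply: slope_weight_homo => //; exact: le_trans vvm.
  by apply: slope_weight_homo => //; exact: le_trans ut.
- move=> u v vmu uv.
  have u0 : 0 <= u by rewrite (le_trans _ vmu)// invr_ge0; lra.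
  apply: slope_tail_diff => //; try exact: slope_weight_ge0.
  move=> t ut /ltW tv; apply/andP; split.
    by apply: slope_weight_nhomo => //; exact: le_trans ut.
  exact: slope_weight_nhomo.
- by move=> v vmv; exact: slope_tail_le.
- exact: slope_tail0_gt0.
Qed.

(** * Norm estimates *)

Section upper_bound.
Context (R : realType).
Local Open Scope ereal_scope.

Lemma measurable_lebesgue_itv (i : interval R) :
  measurable ([set` i] : set (lebesgueType R)).
Proof. by apply: sub_caratheodory; exact: measurable_itv. Qed.
Local Hint Resolve measurable_lebesgue_itv : core.

Lemma leb_itv_oc (c d : R) : (c <= d)%R -> leb R `]c, d]%classic = (d - c)%:E.
Proof.
move=> cd; rewrite (_ : leb R _ = @lebesgue_measure R `]c, d]%classic)//.
rewrite lebesgue_measure_itv/= lte_fin; case: ltP => [_|dc]; first by rewrite EFinB.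
by congr EFin; apply/eqP; rewrite eq_sym subr_eq0 eq_le cd dc.
Qed.

Lemma nonincreasing_lebesgue_measurable (h : R -> \bar R) :
  (forall x y, (0 < x)%R -> (x <= y)%R -> h y <= h x) ->
  @measurable_fun _ _ (lebesgueType R) _ (posline R) h.
Proof.
move=> hni; apply: (measurability (@ErealGenCInfty.G R)) => [|/= _ [_] [r] -> <-].
  exact: ErealGenCInfty.measurableE.
apply: sub_caratheodory; apply: is_interval_measurable => s t/=.
rewrite !in_itv/= !andbT => -[s0 hs] [t0 ht] u /andP[su ut].
have u0 := lt_le_trans s0 su.
by split; rewrite /= in_itv/= andbT//; exact: le_trans ht (hni _ _ u0 ut).
Qed.

Lemma pnormE (p : R) (f : R -> \bar R) : (0 < p)%R ->
  (forall x, (0 < x)%R -> 0 <= f x) ->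
  pnorm p f = (\int[leb R]_(t in posline R) (f t) `^ p) `^ p^-1.
Proof.
move=> p0 f0; rewrite /pnorm unlock; congr (_ `^ _).
rewrite [RHS]integral_mkcond; apply: eq_integral => x _; rewrite !patchE.
case: ifPn => [|_]; last by rewrite abse0 poweR0r// gt_eqF.
by rewrite inE/= in_itv/= andbT => x0; rewrite gee0_abs// f0.
Qed.

Lemma hardyop_ge0 (b f : R -> \bar R) (x : R) :
  (forall t, (0 < t)%R -> 0 <= f t) -> 0 <= hardyop b f x.
Proof. by move=> f0; apply: integral_ge0 => t [t0 _]; exact: f0. Qed.

Lemma measurable_lebesgue_below (y : \bar R) :
  measurable ([set t : R | (0 < t)%R /\ t%:E < y] : set (lebesgueType R)).
Proof.
apply: sub_caratheodory; apply: is_interval_measurable => s t/= [s0 sy] [t0 ty] u.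
move=> /andP[su ut]; split; first exact: lt_le_trans s0 su.
by apply: le_lt_trans ty; rewrite lee_fin.
Qed.

Section fixed_function.
Context (p : R) (f : R -> \bar R).
Hypotheses (p1 : (1 < p)%R) (Lf : Lplus f).

Let mf : @measurable_fun _ _ (lebesgueType R) _ (posline R) f. Proof. by case: Lf. Qed.
Let f0 t : (0 < t)%R -> 0 <= f t. Proof. by case: Lf => _; exact. Qed.
Let p0 : (0 < p)%R. Proof. exact: lt_trans ltr01 p1. Qed.

Let mfp : @measurable_fun _ _ (lebesgueType R) _ (posline R) (fun t => (f t) `^ p).
Proof. exact: (measurableT_comp (measurable_poweR _)). Qed.

Let sub_pos (c d : R) : (0 <= c)%R -> `]c, d]%classic `<=` posline R.
Proof.
move=> c0 t /=; rewrite !in_itv/= andbT => /andP[ct _]; exact: le_lt_trans ct.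
Qed.

Lemma hardyop_nonincreasing (b : R -> \bar R) : normal_form_parameter b ->
  forall x y, (0 < x)%R -> (x <= y)%R -> hardyop b f y <= hardyop b f x.
Proof.
move=> [_ bni] x y x0 xy; apply: ge0_subset_integral.
- exact: measurable_lebesgue_below.
- exact: measurable_lebesgue_below.
- by apply: measurable_funS mf => // t [t0 _]; rewrite /= in_itv/= t0.
- by move=> t [t0 _]; exact: f0.
- by move=> t [t0 tb]; split=> //; exact: lt_le_trans tb (bni _ _ x0 xy).
Qed.

Lemma hardyop_le (b : R -> \bar R) (x d : R) : b x <= d%:E ->
  hardyop b f x <= \int[leb R]_(t in `]0%R, d]) f t.
Proof.
move=> bd; apply: ge0_subset_integral => //.
- exact: measurable_lebesgue_below.
- by apply: measurable_funS mf => //; exact: sub_pos.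
- by move=> t /=; rewrite in_itv/= => /andP[t0 _]; exact: f0.
- move=> t /= [t0 tb]; rewrite in_itv/= t0/= -lee_fin.
  exact: ltW (lt_le_trans tb bd).
Qed.

(** Stated as a sum, without subtraction, since either integral may still be infinite; finiteness of
    the integral of [f] is deduced from it. *)
Lemma integral_powR_tangent (g c d : R) : (0 <= g)%R -> (0 <= c)%R -> (c <= d)%R ->
  (p * g `^ (p - 1))%:E * \int[leb R]_(t in `]c, d]) f t <=
  \int[leb R]_(t in `]c, d]) (f t) `^ p + ((p - 1) * g `^ p * (d - c))%:E.
Proof.
move=> g0 c0 cd.
have pg0 : (0 <= p * g `^ (p - 1))%R by rewrite mulr_ge0 ?powR_ge0 ?(ltW p0).
have pg1 : (0 <= (p - 1) * g `^ p)%R by rewrite mulr_ge0 ?powR_ge0 ?subr_ge0 ?(ltW p1).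
have fg0 t : `]c, d]%classic t -> 0 <= f t.
  by move=> /(sub_pos _ _ c0) /=; rewrite in_itv/= andbT => /f0.
have mf' : @measurable_fun _ _ (lebesgueType R) _ `]c, d]%classic f.
  by apply: measurable_funS mf => //; exact: sub_pos.
have mfp' : @measurable_fun _ _ (lebesgueType R) _ `]c, d]%classic (fun t => (f t) `^ p).
  by apply: measurable_funS mfp => //; exact: sub_pos.
rewrite -ge0_integralZl_EFin//.
rewrite [((p - 1) * _ * _)%:E]EFinM -leb_itv_oc// -integral_cst// -ge0_integralD//; last first.
  by move=> t _; exact: poweR_ge0.
apply: ge0_le_integral; first exact: measurable_lebesgue_itv.
- by move=> t /fg0 ft; rewrite mule_ge0// lee_fin.
- exact: measurable_funeM.
- by apply: emeasurable_funD => //; exact: measurable_cst.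
- move=> t /fg0; case: (f t) => [x| |]//.
  + rewrite lee_fin => x0; rewrite poweR_EFin -EFinM -EFinD lee_fin.
    by rewrite -lerBlDr; exact: powR_tangent.
  + by move=> _; rewrite poweRyr ?gt_eqF// addye// leey.
Qed.

Hypothesis Nfin : \int[leb R]_(t in posline R) (f t) `^ p < +oo.

Let N := fine (\int[leb R]_(t in posline R) (f t) `^ p).
Let F y := fine (\int[leb R]_(t in `]0%R, y]) f t).
Let E y := fine (\int[leb R]_(t in `]0%R, y]) (f t) `^ p).

Let int_split (h : R -> \bar R) (u c d : R) :
  @measurable_fun _ _ (lebesgueType R) _ (posline R) h ->
  (forall t, (0 < t)%R -> 0 <= h t) -> (0 <= u)%R -> (u <= c)%R -> (c <= d)%R ->
  \int[leb R]_(t in `]u, d]) h t =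
  \int[leb R]_(t in `]u, c]) h t + \int[leb R]_(t in `]c, d]) h t.
Proof.
move=> mh h0 u0 uc cd; have udE : `]u, d]%classic = `]u, c]%classic `|` `]c, d]%classic.
  by rewrite -itv_bndbnd_setU//= bnd_simp.
rewrite udE ge0_integral_setU//.
- by rewrite -udE; apply: measurable_funS mh => //; exact: sub_pos.
- by move=> x; rewrite -udE => /(sub_pos _ _ u0)/=; rewrite in_itv/= andbT => /h0.
- apply/disj_setPS => x/= []; rewrite !in_itv/= => /andP[_ xc] /andP[cx _].
  by move: (lt_le_trans cx xc); rewrite ltxx.
Qed.

Let E_le_N y : \int[leb R]_(t in `]0%R, y]) (f t) `^ p <= N%:E.
Proof.
rewrite /N fineK; last first.
  by rewrite ge0_fin_numE//; apply: integral_ge0 => t _; exact: poweR_ge0.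
apply: ge0_subset_integral => //; last exact: sub_pos.
by move=> t _; exact: poweR_ge0.
Qed.

Let EfinE y : \int[leb R]_(t in `]0%R, y]) (f t) `^ p = (E y)%:E.
Proof.
rewrite /E fineK// ge0_fin_numE; first exact: le_lt_trans (E_le_N y) (ltry _).
by apply: integral_ge0 => t _; exact: poweR_ge0.
Qed.

Let FfinE y : (0 <= y)%R -> \int[leb R]_(t in `]0%R, y]) f t = (F y)%:E.
Proof.
move=> y0; rewrite /F fineK// ge0_fin_numE; last first.
  by apply: integral_ge0 => t /=; rewrite in_itv/= => /andP[/f0].
(* The tangent at 1 already gives local integrability: [p F <= E + (p-1) y]. *)
have := integral_powR_tangent 1 0 y ler01 (lexx _) y0.
rewrite EfinE -EFinD powR1 mulr1 => H.
rewrite ltey; apply/eqP => Foo; move: H; rewrite Foo mulry gtr0_sg// mul1e.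
by rewrite leye_eq.
Qed.

Let F_split c d : (0 <= c)%R -> (c <= d)%R ->
  \int[leb R]_(t in `]c, d]) f t = (F d - F c)%:E.
Proof.
move=> c0 cd; have d0 := le_trans c0 cd.
have := int_split f 0 c d mf f0 (lexx _) c0 cd.
rewrite !FfinE// => H; rewrite EFinB H addeAC subee// add0e//.
Qed.

Let E_split c d : (0 <= c)%R -> (c <= d)%R ->
  \int[leb R]_(t in `]c, d]) (f t) `^ p = (E d - E c)%:E.
Proof.
move=> c0 cd; have := int_split _ 0 c d mfp (fun t _ => poweR_ge0 _ _) (lexx _) c0 cd.
by rewrite !EfinE// => H; rewrite EFinB H addeAC subee// add0e.
Qed.

Let F_homo c d : (0 <= c)%R -> (c <= d)%R -> (F c <= F d)%R.
Proof.
move=> c0 cd; rewrite -subr_ge0 -lee_fin -F_split//.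
apply: integral_ge0 => t /(sub_pos _ _ c0) /=; rewrite in_itv/= andbT; exact: f0.
Qed.

Let EF_tangent g c d : (0 <= g)%R -> (0 <= c)%R -> (c <= d)%R ->
  (p * g `^ (p - 1) * (F d - F c) - (p - 1) * g `^ p * (d - c) <= E d - E c)%R.
Proof.
move=> g0 c0 cd; have := integral_powR_tangent g c d g0 c0 cd.
by rewrite F_split// E_split// -EFinM -EFinD lee_fin lerBlDr.
Qed.

Let F0E : F 0 = 0%R. Proof. by rewrite /F set_itvoc0 integral_set0. Qed.
Let E0E : E 0 = 0%R. Proof. by rewrite /E set_itvoc0 integral_set0. Qed.

Context (q A : R) (b : R -> \bar R).
Hypotheses (pq : (p <= q)%R) (A0 : (0 < A)%R) (nb : normal_form_parameter b).
Hypothesis (bA : Defs.A0 p q b <= A%:E).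

Let k := (q - q / p)%R.
(** Inverse of the majorant [x -> (A / x^(1/q))^p'] of [b], as [k = q/p']. *)
Let X (y : R) : R := (A `^ q * y `^ (- k))%R.
Let H := hardyop b f.

Let q0 : (0 < q)%R. Proof. exact: lt_le_trans p0 pq. Qed.
Let q1 : (1 < q)%R. Proof. exact: lt_le_trans p1 pq. Qed.
Let k0 : (0 < k)%R.
Proof. by rewrite subr_gt0 ltr_pdivrMr// -[ltLHS]mulr1 ltr_pM2l. Qed.

Let b_le x d : (0 < d)%R -> (X d < x)%R -> b x <= d%:E.
Proof.
move=> d0 Xx; have x0 : (0 < x)%R.
  by apply: le_lt_trans Xx; rewrite mulr_ge0 ?powR_ge0.
rewrite leNgt; apply/negP => dx; move: Xx; rewrite ltNge => /negP; apply.
have pV : (0 < 1 - p^-1)%R by rewrite subr_gt0 invf_lt1.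
have cV : ((conj_exp p)^-1 = 1 - p^-1)%R by rewrite -(conj_expP p1) addrAC subrr add0r.
have : (d `^ (1 - p^-1) * x `^ q^-1)%:E <= A%:E.
  apply: le_trans bA; apply: le_trans (ereal_sup_ubound _); last first.
    by exists x => //=; rewrite in_itv/= x0.
  rewrite EFinM; apply: lee_wpmul2r; first by rewrite lee_fin powR_ge0.
  rewrite cV -poweR_EFin; apply: gt0_ler_poweR; rewrite ?in_itv/= ?leey ?andbT ?(ltW pV)//.
  - by rewrite lee_fin ltW.
  - by case: nb => bge0 _; rewrite bge0.
  - exact: ltW.
rewrite lee_fin => /(ler_powR_base _ _ _ _ (ltW q0)).
rewrite mulr_ge0 ?powR_ge0// => /(_ isT).
rewrite powRM ?powR_ge0// -!powRrM mulVf ?gt_eqF// powRr1 ?(ltW x0)// => Hx.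
rewrite /X powRN -ler_pdivrMr ?invr_gt0 ?powR_gt0// invrK mulrC.
by rewrite (_ : k = (1 - p^-1) * q)%R// /k; ring.
Qed.

Let H0 x : 0 <= H x. Proof. exact: hardyop_ge0. Qed.

Let mH : @measurable_fun _ _ (lebesgueType R) _ (posline R) (fun x => H x `^ q).
Proof.
apply: (measurableT_comp (measurable_poweR _)).
by apply: nonincreasing_lebesgue_measurable; exact: hardyop_nonincreasing.
Qed.

Let X_gt0 y : (0 < y)%R -> (0 < X y)%R.
Proof. by move=> y0; rewrite mulr_gt0 ?powR_gt0. Qed.

Let X_nhomo c d : (0 < c)%R -> (c <= d)%R -> (X d <= X c)%R.
Proof.
by move=> c0 cd; rewrite ler_wpM2l ?powR_ge0// ler_powRN_base ?(ltW k0).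
Qed.

(** For [x > X d], [b x <= d] and hence [H x <= F d]. As [X] reverses the order, this is the source
    of the hypothesis on [I]. *)
Let int_H_le c d : (0 < c)%R -> (c <= d)%R ->
  \int[leb R]_(x in `]X d, X c]) H x `^ q <= (F d `^ q * (X c - X d))%:E.
Proof.
move=> c0 cd; have d0 := lt_le_trans c0 cd; have Xdc := X_nhomo _ _ c0 cd.
rewrite EFinM -leb_itv_oc// -integral_cst//; apply: ge0_le_integral.
- exact: measurable_lebesgue_itv.
- by move=> x _; exact: poweR_ge0.
- by apply: measurable_funS mH => //; apply: sub_pos; exact: ltW (X_gt0 _ d0).
- exact: measurable_cst.
- move=> x /=; rewrite in_itv/= => /andP[Xdx _].
  have HF : H x <= (F d)%:E.
    by rewrite -FfinE ?(ltW d0)//; apply: hardyop_le; exact: b_le.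
  rewrite -poweR_EFin; apply: gt0_ler_poweR; rewrite ?in_itv/= ?leey ?andbT ?(ltW q0)//.
  exact: le_trans (H0 x) HF.
Qed.

Let truncated_norm_le a d : (0 < a)%R -> (a <= d)%R ->
  \int[leb R]_(x in `]X d, X a]) H x `^ q <=
  ((bliss_const p q * A) `^ q * N `^ (q / p))%:E.
Proof.
move=> a0 ad; have d0 := lt_le_trans a0 ad.
have [J JE] : exists J, forall c, J c = \int[leb R]_(x in `]X c, X a]) H x `^ q.
  by exists (fun c => \int[leb R]_(x in `]X c, X a]) H x `^ q).
have Jfin c : (a <= c)%R -> J c = (fine (J c))%:E.
  move=> ac; rewrite fineK// ge0_fin_numE; last first.
    by rewrite JE; apply: integral_ge0 => x _; exact: poweR_ge0.
  by rewrite JE; exact: le_lt_trans (int_H_le _ _ a0 ac) (ltry _).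
(* Dividing by [A^q] turns [X] into the bare power [y^(-k)]. *)
pose I c := (A `^ (- q) * fine (J c))%R.
have Aq : (0 < A `^ q)%R by rewrite powR_gt0.
have Jsplit c e : (a <= c)%R -> (c <= e)%R ->
    ((fine (J e) - fine (J c))%:E = \int[leb R]_(x in `]X e, X c]) H x `^ q).
  move=> ac ce; have c0 := lt_le_trans a0 ac; have e0 := lt_le_trans c0 ce.
  have Jec : J e = \int[leb R]_(x in `]X e, X c]) H x `^ q + J c.
    rewrite !JE; exact: int_split _ (X e) (X c) (X a) mH (fun t _ => poweR_ge0 _ _)
      (ltW (X_gt0 _ e0)) (X_nhomo _ _ c0 ce) (X_nhomo _ _ a0 ac).
  have Je := Jfin e (le_trans ac ce); have Jc := Jfin c ac.
  by rewrite EFinB -Je -Jc Jec addeK// Jc.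
have : (I d - I a <= bliss_const p q `^ q * E d `^ (q / p))%R.
  apply: (@truncated_bliss R p q a d F E I p1 pq a0 ad).
  - by rewrite -F0E F_homo ?(ltW a0).
  - by move=> c e ac ce _; apply: F_homo => //; exact: le_trans (ltW a0) ac.
  - by move=> g c e g0 ac ce _; apply: EF_tangent => //; exact: le_trans (ltW a0) ac.
  - move=> c e ac ce _; have c0 := lt_le_trans a0 ac.
    have := int_H_le _ _ c0 ce; rewrite -Jsplit// lee_fin /X -mulrBr => Hce.
    rewrite /I -mulrBr powRN mulrC ler_pdivrMr//; apply: (le_trans Hce).
    by rewrite mulrCA mulrC.
  (* Jensen's inequality on []0, a]]: the tangent is taken at the mean value [F a / a] of [f]. *)
  - have g0 : (0 <= F a / a)%R by rewrite divr_ge0 ?(ltW a0)// -F0E F_homo ?(ltW a0).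
    have := EF_tangent (F a / a)%R 0%R a g0 (lexx _) (ltW a0).
    rewrite F0E E0E !subr0; apply: le_trans.
    rewrite -(mulr_powRB1 g0 p0) le_eqVlt; apply/orP; left; apply/eqP.
    by field; rewrite gt_eqF.
  - by rewrite -lee_fin -EfinE; apply: integral_ge0 => t _; exact: poweR_ge0.
have -> : I a = 0%R by rewrite /I JE set_itvoc0 integral_set0 mulr0.
rewrite subr0 /I powRN mulrC ler_pdivrMr// => Hd.
rewrite -JE Jfin// lee_fin; apply: (le_trans Hd).
rewrite powRM ?(ltW (bliss_const_gt0 _ _ _ _ _)) ?(ltW A0)// mulrAC.
apply: ler_wpM2l; first by rewrite mulr_ge0 ?powR_ge0.
apply: ler_powR_base.
- by rewrite divr_ge0 ?(ltW q0) ?(ltW p0).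
- by rewrite -lee_fin -EfinE; apply: integral_ge0 => t _; exact: poweR_ge0.
- by rewrite -lee_fin -EfinE.
Qed.

Lemma hardyop_norm_le :
  pnorm q (hardyop b f) <= (bliss_const p q * A)%:E * pnorm p f.
Proof.
have K0 := bliss_const_gt0 R p q p1 pq.
have KA0 : (0 <= bliss_const p q * A)%R by rewrite mulr_ge0 ?(ltW K0) ?(ltW A0).
have N0 : (0 <= N)%R.
  by rewrite fine_ge0//; apply: integral_ge0 => t _; exact: poweR_ge0.
have main : \int[leb R]_(x in posline R) H x `^ q <=
    ((bliss_const p q * A) `^ q * N `^ (q / p))%:E.
  pose S (n : nat) : set (lebesgueType R) := `](n.+1%:R^-1)%R, (n.+1%:R)%R]%classic.
  have Spos n : S n `<=` posline R by apply: sub_pos; rewrite invr_ge0.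
  have SU : \bigcup_n S n = posline R.
    apply/seteqP; split => [x [n _ /Spos]//|x /=]; rewrite in_itv/= andbT => x0.
    pose n := maxn (Num.truncn x) (Num.truncn x^-1).
    exists n => //=; rewrite /S/= in_itv/=.
    have /andP[_ xn] := truncn_itv (ltW x0).
    have xV0 : (0 < x^-1)%R by rewrite invr_gt0.
    have /andP[_ xn'] := truncn_itv (ltW xV0).
    apply/andP; split; last first.
      by rewrite (le_trans (ltW xn))// ler_nat ltnS leq_maxl.
    rewrite -[ltRHS]invrK ltf_pV2 ?posrE//.
    by rewrite (lt_le_trans xn')// ler_nat ltnS leq_maxr.
  have ndS : nondecreasing_seq S.
    move=> n m nm; rewrite subsetEset => x /=; rewrite /S/= !in_itv/= => /andP[nx xn].
    rewrite (le_trans xn) ?ler_nat ?ltnS// andbT (le_lt_trans _ nx)//.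
    by rewrite lef_pV2 ?posrE// ler_nat ltnS.
  have cvgS := @ge0_nondecreasing_set_cvg_integral _ _ R S (fun x => H x `^ q) (leb R) ndS
    (fun n => measurable_lebesgue_itv _) (fun n => measurable_funS (measurable_lebesgue_itv _) (Spos n) mH)
    (fun n x _ => poweR_ge0 _ _).
  rewrite -SU -(cvg_lim _ cvgS)//.
  apply: lime_le; first by apply/cvg_ex; eexists; exact: cvgS.
  near=> n.
  pose Xi (u : R) := ((u / A `^ q) `^ (- k^-1))%R.
  have XiK u : (0 < u)%R -> X (Xi u) = u.
    move=> u0; have uA : (0 < u / A `^ q)%R by rewrite divr_gt0 ?powR_gt0.
    rewrite /X /Xi -powRrM mulrNN mulVf ?gt_eqF// powRr1 ?(ltW uA)//.
    by rewrite mulrC divfK// gt_eqF// powR_gt0.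
  have n0 : (0 < n.+1%:R :> R)%R by [].
  have nV0 : (0 < n.+1%:R^-1 :> R)%R by rewrite invr_gt0.
  have := @truncated_norm_le (Xi n.+1%:R) (Xi n.+1%:R^-1)%R.
  rewrite !XiK//; apply.
    by rewrite powR_gt0// divr_gt0// powR_gt0.
  rewrite ler_powRN_base ?invr_ge0 ?(ltW k0)//.
    by rewrite divr_gt0// powR_gt0.
  rewrite ler_wpM2r ?invr_ge0 ?powR_ge0//.
  by rewrite (le_trans _ (_ : 1 <= _)%R) ?ler1n// invf_le1// ler1n.
rewrite !pnormE//.
rewrite (_ : \int[leb R]_(t in posline R) f t `^ p = N%:E); last first.
  by rewrite /N fineK// ge0_fin_numE//; apply: integral_ge0 => t _; exact: poweR_ge0.
rewrite poweR_EFin -EFinM.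
apply: (@le_trans _ _ (((bliss_const p q * A) `^ q * N `^ (q / p))%:E `^ q^-1)).
  apply: gt0_ler_poweR; rewrite ?in_itv/= ?leey ?andbT ?invr_ge0 ?(ltW q0)//.
  - by apply: integral_ge0 => t _; exact: poweR_ge0.
  - by rewrite lee_fin mulr_ge0 ?powR_ge0.
rewrite poweR_EFin lee_fin powRM ?powR_ge0// -!powRrM divff ?gt_eqF//.
rewrite powRr1// (_ : q / p / q = p^-1)%R//.
by field; rewrite !gt_eqF.
Unshelve. all: by end_near. Qed.

End fixed_function.
End upper_bound.

(** * The lower bound, and the two bounds combined *)

Lemma norm_bounds_ge (R : realType) (p q : R) (b : R -> \bar R) (C : \bar R)
    (x y : R) : 1 < p -> p <= q -> normal_form_parameter b ->
  norm_bounds p q b C -> 0 < x -> 0 < y -> (y%:E < b x)%E ->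
  ((y * x `^ q^-1)%:E <= C * (y `^ p^-1)%:E)%E.
Proof.
move=> p1 pq nb [C0 HC] x0 y0 yb.
have p0 : 0 < p := lt_trans ltr01 p1; have q0 : 0 < q := lt_le_trans p0 pq.
have mitv := @measurable_lebesgue_itv R.
pose f (t : R) : \bar R := (\1_(`]0, y]%classic : set R) t)%:E.
have f0 t : (0 <= f t)%E by rewrite lee_fin.
have mf : @measurable_fun _ _ (lebesgueType R) _ setT f.
  by apply/measurable_EFinP; exact: measurable_indic.
have Lf : Lplus f by split => [|t _]; [exact: measurable_funTS|exact: f0].
have fp : pnorm p f = (y `^ p^-1)%:E.
  rewrite pnormE// -poweR_EFin; congr (_ `^ _)%E.
  transitivity (\int[leb R]_(t in posline R) f t)%E.
    apply: eq_integral => t _; rewrite /f indicE; case: (_ \in _) => /=.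
      by rewrite powR1.
    by rewrite powR0// gt_eqF.
  rewrite integral_indic//.
  rewrite setIidl; first by rewrite leb_itv_oc ?(ltW y0)// subr0.
  by move=> t /=; rewrite !in_itv/= andbT => /andP[].
have {HC} := HC f Lf; rewrite fp => /(_ (ltry _)); apply: le_trans.
rewrite pnormE//; last by move=> t _; exact: hardyop_ge0.
(* Monotonicity of [b] carries [y < b x] over to every [t <= x], so the whole of []0, y]] is
   integrated. *)
have Hy t : `]0, x]%classic t -> (y%:E <= hardyop b f t)%E.
  rewrite /= in_itv/= => /andP[t0 tx].
  apply: (@le_trans _ _ (\int[leb R]_(u in `]0%R, y]) f u)%E).
    rewrite integral_indic//.
    by rewrite setIid leb_itv_oc ?(ltW y0)// subr0.
  apply: ge0_subset_integral => //.
  - exact: measurable_lebesgue_below.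
  - exact: measurable_funTS.
  - move=> u /=; rewrite in_itv/= => /andP[u0 uy]; split=> //.
    by apply: le_lt_trans (lt_le_trans yb (nb.2 _ _ t0 tx)); rewrite lee_fin.
have mH : @measurable_fun _ _ (lebesgueType R) _ (posline R) (fun t => (hardyop b f t `^ q)%E).
  apply: (measurableT_comp (measurable_poweR _)).
  by apply: nonincreasing_lebesgue_measurable; exact: hardyop_nonincreasing.
have sub : `]0, x]%classic `<=` posline R.
  by move=> t /=; rewrite !in_itv/= andbT => /andP[].
have Hx : ((y `^ q * x)%:E <= \int[leb R]_(t in posline R) hardyop b f t `^ q)%E.
  apply: (@le_trans _ _ (\int[leb R]_(t in `]0%R, x]) hardyop b f t `^ q)%E).
    have -> : x = x - 0 by rewrite subr0.
    rewrite EFinM -leb_itv_oc ?(ltW x0)// subr0 -integral_cst; last exact: mitv.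
    apply: ge0_le_integral.
    - exact: mitv.
    - by move=> t _; rewrite lee_fin powR_ge0.
    - exact: measurable_cst.
    - exact: measurable_funS mH.
    - move=> t /Hy Ht; rewrite /= -poweR_EFin.
      apply: gt0_ler_poweR => //; rewrite ?in_itv/= ?leey ?andbT ?(ltW q0)//.
      + by rewrite lee_fin ltW.
      + exact: hardyop_ge0.
  by apply: ge0_subset_integral => // t _; exact: poweR_ge0.
apply: (@le_trans _ _ ((y `^ q * x)%:E `^ q^-1)%E).
  rewrite poweR_EFin powRM ?powR_ge0 ?(ltW x0)// -powRrM divff ?gt_eqF//.
  by rewrite powRr1 ?(ltW y0).
apply: gt0_ler_poweR; rewrite ?in_itv/= ?leey ?andbT ?invr_ge0 ?(ltW q0)//.
- by rewrite lee_fin mulr_ge0 ?powR_ge0// ltW.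
- by apply: integral_ge0 => t _; exact: poweR_ge0.
Qed.

Lemma A0_le_opnorm (R : realType) (p q : R) (b : R -> \bar R) :
  1 < p -> p <= q -> normal_form_parameter b -> (A0 p q b <= opnorm p q b)%E.
Proof.
move=> p1 pq nb; have p0 : 0 < p := lt_trans ltr01 p1.
have q1 : 1 < q := lt_le_trans p1 pq.
have [bC _] := opnorm_least b p1 q1.
set C := opnorm p q b in bC *.
apply: ge_ereal_sup => z [x /= + <-]; rewrite in_itv/= andbT => x0 {z}.
have bx0 : (0 <= b x)%E by apply: nb.1.
have pV : 0 < 1 - p^-1 by rewrite subr_gt0 invf_lt1.
have -> : (conj_exp p)^-1 = 1 - p^-1 by rewrite -(conj_expP p1) addrAC subrr add0r.
have key y : 0 < y -> (y%:E < b x)%E -> ((y `^ (1 - p^-1) * x `^ q^-1)%:E <= C)%E.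
  move=> y0 yb; have := norm_bounds_ge R p q b C x y p1 pq nb bC x0 y0 yb.
  have yp : 0 < y `^ p^-1 by rewrite powR_gt0.
  rewrite -lee_pdivrMr// -EFinM; congr (_%:E <= _)%E.
  rewrite mulrAC; congr (_ * _).
  by rewrite powRB ?powRr1 ?(ltW y0)//; apply/implyP => _; rewrite gt_eqF.
case: C bC key => [c| |] bC key; [|by rewrite leey|by case: bC].
have c0 : 0 <= c by case: bC.
have xq : 0 < x `^ q^-1 by rewrite powR_gt0.
(* The solution of [M^(1-1/p) x^(1/q) = c]. Every real [y < b x] is at most [M]; testing [M + 1]
   excludes [b x = +oo], and a midpoint between [M] and [b x] excludes [M < b x]. *)
pose M := (c / x `^ q^-1) `^ (1 - p^-1)^-1.
have yM y : 0 < y -> (y%:E < b x)%E -> y <= M.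
  move=> y0 yb; have := key y y0 yb; rewrite lee_fin -ler_pdivlMr// => H.
  have -> : y = (y `^ (1 - p^-1)) `^ (1 - p^-1)^-1.
    by rewrite -powRrM divff ?gt_eqF// powRr1// ltW.
  by apply: ler_powR_base H; rewrite ?invr_ge0 ?powR_ge0 ?(ltW pV).
have M0 : 0 <= M by exact: powR_ge0.
case: (b x) bx0 yM {key} => [y| |] // bx0 yM; last first.
  have := yM (M + 1); rewrite ltry => /(_ _ isT); rewrite ltr_wpDl// => /(_ isT).
  by rewrite gerDl ler10.
have yM' : y <= M.
  rewrite leNgt; apply/negP => My.
  have := yM ((M + y) / 2); rewrite lte_fin midf_lt// => /(_ _ isT).
  rewrite divr_gt0 ?ltr_wpDl ?(le_lt_trans M0 My)// => /(_ isT).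
  by rewrite leNgt midf_lt.
rewrite poweR_EFin -EFinM lee_fin -ler_pdivlMr//.
have -> : c / x `^ q^-1 = M `^ (1 - p^-1).
  by rewrite -powRrM mulVf ?gt_eqF// powRr1// divr_ge0 ?powR_ge0.
by apply: ler_powR_base yM'; rewrite ?(ltW pV).
Qed.

Theorem theorem3p8 (R : realType) (p q : R) (b : R -> \bar R) :
  1 < p -> p <= q -> normal_form_parameter b ->
  (A0 p q b <= opnorm p q b)%E /\
  (opnorm p q b <= (bliss_const p q)%:E * A0 p q b)%E.
Proof.
move=> p1 pq nb; split; first exact: A0_le_opnorm.
have p0 : 0 < p := lt_trans ltr01 p1.
have K0 := bliss_const_gt0 R p q p1 pq.
have A00 : (0 <= A0 p q b)%E.
  apply: le_trans (ereal_sup_ubound _); last first.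
    by exists 1 => //=; rewrite in_itv/= ltr01.
  by rewrite mule_ge0 ?poweR_ge0// lee_fin powR_ge0.
case AE : (A0 p q b) A00 => [A| |] // A00; last by rewrite gt0_muley ?leey.
(* [A] may be 0, whereas the change of variable [X] needs a positive amplitude; [A + d] is used
   instead, with [d] such that the bound grows by [e]. *)
apply/lee_addgt0Pr => e e0.
pose d := e / bliss_const p q.
have d0 : 0 < d by rewrite divr_gt0.
have Ad : 0 < A + d by rewrite ltr_wpDl.
have -> : ((bliss_const p q)%:E * A%:E + e%:E = (bliss_const p q * (A + d))%:E)%E.
  by rewrite -EFinM -EFinD mulrDr /d mulrCA divff ?mulr1// gt_eqF.
apply: ereal_inf_lbound; split; first by rewrite lee_fin mulr_ge0 ?(ltW K0) ?(ltW Ad).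
move=> f Lf; have [_ f0] := Lf => fp.
apply: hardyop_norm_le => //; last by rewrite AE lee_fin lerDl ltW.
move: fp; rewrite pnormE//; apply: lty_poweRy.
by rewrite invr_eq0 gt_eqF.
Qed.
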